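(* Let $\mathcal{K}\subseteq\mathbb{R}^n$ be a convex body symmetric with respect to a point $o$, and let $m\ge0$ be an integer. Then $\psi_m(\mathcal{K})\ge\psi_m(\mathbb{B}_2^n)$.
   Context: A convex body is a compact convex set with nonempty interior. A set $\mathcal{K}$ is $o$-symmetric if $x\in\mathcal{K}$ implies $2o-x\in\mathcal{K}$. For an $o$-symmetric convex body $\mathcal{K}$, $\psi_m(\mathcal{K})=\sup\{\operatorname{vol}\mathcal{P}/\operatorname{vol}\mathcal{K}\colon \mathcal{P}\subset\mathcal{K}\text{ a convex polytope with at most } m \text{ vertices that is } o\text{-symmetric}\}$. $\mathbb{B}_2^n$ is the Euclidean unit ball, considered as symmetric about its center (the origin). *)

(* Defs.v *)
From HB Require Import structures.
From mathcomp Require Import all_boot all_order all_algebra.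
From mathcomp Require Import all_classical all_reals all_analysis.
Set Implicit Arguments. Unset Strict Implicit. Unset Printing Implicit Defensive.
Import Order.TTheory GRing.Theory Num.Theory.
Import numFieldNormedType.Exports.
Local Open Scope classical_set_scope.
Local Open Scope ring_scope.

(* Points of R^n are row vectors 'rV[R]_n; the topology is the canonical
   (product / max-norm) topology of MathComp-Analysis, equivalent to the
   Euclidean one. *)

Section Geom.
Variables (R : realType) (n : nat).
Notation V := 'rV[R]_n.

Definition convex_set (A : set V) : Prop :=
  forall x y (t : R), A x -> A y -> 0 <= t -> t <= 1 -> A (t *: x + (1 - t) *: y).

Definition convex_body (K : set V) : Prop :=
  [/\ convex_set K, compact K & (interior K !=set0)].

Definition sym_about (o : V) (A : set V) : Prop :=
  forall x, A x -> A (2 *: o - x).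

Definition conv_hull (k : nat) (v : 'I_k -> V) : set V :=
  [set x | exists l : 'I_k -> R, (forall i, 0 <= l i) /\ \sum_(i < k) l i = 1
           /\ x = \sum_(i < k) l i *: v i].

Definition polytope_le (m : nat) (P : set V) : Prop :=
  exists k (v : 'I_k -> V), (k <= m)%N /\ P = conv_hull v.

Definition box (a b : V) : set V := [set x | forall i, a 0 i <= x 0 i <= b 0 i].
Definition box_vol (a b : V) : R := \prod_(i < n) (b 0 i - a 0 i).

Definition vol (A : set V) : \bar R :=
  ereal_inf [set s : \bar R | exists (a b : nat -> V),
     [/\ (forall k i, a k 0 i <= b k 0 i),
         A `<=` \bigcup_k box (a k) (b k) &
         s = (\sum_(0 <= k <oo) (box_vol (a k) (b k))%:E)%E]].

Definition psi (m : nat) (K : set V) (o : V) : \bar R :=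
  ereal_sup [set r : \bar R | exists P : set V,
     [/\ polytope_le m P, P `<=` K, sym_about o P &
         r = (fine (vol P) / fine (vol K))%:E]].

Definition unit_ball : set V := [set x | \sum_(i < n) (x 0 i) ^+ 2 <= 1].

End Geom.

(* Main.v *)
From HB Require Import structures.
From mathcomp Require Import all_boot all_order all_algebra.
From mathcomp Require Import fingroup perm.
From mathcomp Require Import all_classical all_reals all_analysis.
From mathcomp Require Import measurable_realfun.
From mathcomp Require Import ring lra.
Import Order.TTheory GRing.Theory Num.Theory.
Import numFieldNormedType.Exports.
Require Import Defs.
Set Implicit Arguments. Unset Strict Implicit. Unset Printing Implicit Defensive.
Local Open Scope classical_set_scope.
Local Open Scope ring_scope.

(** Steiner symmetrization does not increase psi_m. If P is a symmetric polytope
    inside the symmetral of K along u, its vertices can be moved parallel to u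
    into K in two ways, the second one being a mirror image, and on every line
    parallel to u the two resulting polytopes have together chords at least
    twice as long as P; by Tonelli one of them has at least the volume of P.
    Minimality of the vertex set makes it symmetric, so that the displacements
    can be chosen odd and the new polytopes are again symmetric.

    Finitely many symmetrizations bring K between two concentric balls of ratio
    t < 1. A body inside the unit ball that does not contain the ball of radius t
    misses a cap of the sphere. Symmetrizing along z0 - z makes the body invariant
    under the reflection that exchanges z0 and z, so a cap missed around z0 is
    afterwards also missed around z, while the caps missed before only shrink
    slightly. After running through a finite net of the sphere the body fits into
    a ball of radius delta < 1 depending only on t. This cannot go on forever,
    because the volume never decreases. *)

(** * Powers of a measure *)

Lemma measurable_preimage d d' (T : measurableType d) (T' : measurableType d')
    (f : T -> T') (A : set T') :
  measurable_fun setT f -> measurable A -> measurable (f @^-1` A).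
Proof. by move=> mf mA; rewrite -[X in measurable X]setTI; exact: mf. Qed.

Section PowerMeasure.
Context d (T : measurableType d) (R : realType).
Variable mu : {sigma_finite_measure set T -> \bar R}.

Definition cons_pair n (p : T * n.-tuple T) : n.+1.-tuple T := [tuple of p.1 :: p.2].

Definition uncons_pair n (t : n.+1.-tuple T) : T * n.-tuple T :=
  (thead t, [tuple of behead t]).

Lemma cons_pairK n : cancel (@cons_pair n) (@uncons_pair n).
Proof.
by case=> x t; rewrite /uncons_pair /cons_pair theadE; congr pair; apply: val_inj.
Qed.

Lemma measurable_cons_pair n : measurable_fun setT (@cons_pair n).
Proof. exact: measurable_cons. Qed.

Lemma measurable_uncons_pair n : measurable_fun setT (@uncons_pair n).
Proof.
apply: measurable_fun_pair; last exact: measurable_behead.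
exact: (@measurable_tnth _ _ _ ord0).
Qed.

Lemma measurable_tuple_box n (X : 'I_n -> set T) : (forall i, measurable (X i)) ->
  measurable [set t : n.-tuple T | forall i, X i (tnth t i)].
Proof.
move=> mX; rewrite (_ : mkset _ = \bigcap_(i in [set: 'I_n]) ((@tnth n T)^~ i @^-1` X i)).
  apply: fin_bigcap_measurable => // i _.
  by apply: measurable_preimage => //; exact: measurable_tnth.
by apply/seteqP; split=> t Xt i *; exact: Xt.
Qed.

Section Step.
Variables (n : nat) (nu : {sigma_finite_measure set (n.-tuple T) -> \bar R}).

Definition cons_measure := pushforward (mu \x nu)%E (@cons_pair n).

(* Must be in the context: [done] uses it for the premise of the pushforward instance. *)
Let mcons := @measurable_cons_pair n.

Let cons_measure0 : cons_measure set0 = 0%E.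
Proof. by rewrite /cons_measure /pushforward preimage_set0 measure0. Qed.

Let cons_measure_ge0 A : (0 <= cons_measure A)%E.
Proof. exact: measure_ge0. Qed.

Let cons_measure_sigma_additive : semi_sigma_additive cons_measure.
Proof. exact: measure_semi_sigma_additive. Qed.

HB.instance Definition _ := isMeasure.Build _ _ _ cons_measure
  cons_measure0 cons_measure_ge0 cons_measure_sigma_additive.

Lemma cons_measure_setX (A : set T) (B : set (n.-tuple T)) :
  measurable A -> measurable B ->
  cons_measure (@uncons_pair n @^-1` (A `*` B)) = (mu A * nu B)%E.
Proof.
move=> mA mB; rewrite /cons_measure /pushforward -comp_preimage.
rewrite (_ : _ \o _ = id) ?preimage_id; last by apply/funext => p /=; rewrite cons_pairK.
exact: product_measure1E.
Qed.

Lemma cons_measure_sigma_finite : sigma_finite setT cons_measure.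
Proof.
have /sigma_finiteP[F [TF ndF Foo]] := sigma_finiteT mu.
have /sigma_finiteP[G [TG ndG Goo]] := sigma_finiteT nu.
exists (fun k => @uncons_pair n @^-1` (F k `*` G k)).
  rewrite -preimage_bigcup (_ : \bigcup_k _ = setT) ?preimage_setT//.
  rewrite -setXTT TF TG predeqE => -[x y]; split.
    by move=> [k _ []/= ? ?]; split; exists k.
  move=> [/= [k _ Fkx] [l _ Gly]]; exists (maxn k l) => //; split.
  - by move: x Fkx; exact/subsetPset/ndF/leq_maxl.
  - by move: y Gly; exact/subsetPset/ndG/leq_maxr.
move=> k; have [mF Fk] := Foo k; have [mG Gk] := Goo k; split.
  by apply: measurable_preimage; [exact: measurable_uncons_pair | exact: measurableX].
by rewrite cons_measure_setX// lte_mul_pinfty// ge0_fin_numE.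
Qed.

HB.instance Definition _ :=
  Measure_isSigmaFinite.Build _ _ _ cons_measure cons_measure_sigma_finite.

End Step.

Fixpoint power_measure n : {sigma_finite_measure set (n.-tuple T) -> \bar R} :=
  match n with
  | 0 => \d_([tuple] : 0.-tuple T)
  | n.+1 => cons_measure (power_measure n)
  end.

Lemma power_measure_integral_head n (A : set (n.+1.-tuple T)) : measurable A ->
  power_measure n.+1 A =
  (\int[mu]_s power_measure n [set y | A (cons_pair (s, y))])%E.
Proof.
move=> mA; rewrite /= /cons_measure /pushforward /product_measure1 /=.
apply: eq_integral => s _ /=; congr (power_measure n _).
by apply/seteqP; split=> y /=; rewrite /xsection /= inE.
Qed.

Lemma ysection_preimage_cons_pair n (A : set (n.+1.-tuple T)) y :
  ysection (@cons_pair n @^-1` A) y = [set s | A (cons_pair (s, y))].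
Proof. by apply/seteqP; split=> s /=; rewrite /ysection /= inE. Qed.

Lemma power_measure_integral_behead n (A : set (n.+1.-tuple T)) : measurable A ->
  power_measure n.+1 A =
  (\int[power_measure n]_y mu [set s | A (cons_pair (s, y))])%E.
Proof.
move=> mA; rewrite /= /cons_measure /pushforward.
rewrite (@product_measure_unique _ _ _ _ _ _ _ (product_measure2 mu (power_measure n)))//.
- by apply: eq_integral => y _ /=; rewrite ysection_preimage_cons_pair.
- by move=> ? ? ? ?; exact: product_measure2E.
- by apply: measurable_preimage => //; exact: measurable_cons_pair.
Qed.

Lemma measurable_fun_head_section n (A : set (n.+1.-tuple T)) : measurable A ->
  measurable_fun setT (fun y : n.-tuple T => mu [set s | A (cons_pair (s, y))]).
Proof.
move=> /(measurable_preimage (@measurable_cons_pair n)) /(@measurable_fun_ysection _ _ _ _ _ mu).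
by congr (measurable_fun _ _); apply/funext => y; rewrite /= ysection_preimage_cons_pair.
Qed.

Lemma power_measure_box n (X : 'I_n -> set T) : (forall i, measurable (X i)) ->
  power_measure n [set t | forall i, X i (tnth t i)] = (\prod_(i < n) mu (X i))%E.
Proof.
elim: n X => [|n IHn] X mX.
  rewrite big_ord0; have -> : [set t : 0.-tuple T | forall i : 'I_0, X i (tnth t i)] = setT.
    by apply/seteqP; split=> // t _ [].
  exact: diracT.
have mXS i : measurable (X (lift ord0 i)) by [].
rewrite big_ord_recl -IHn// -cons_measure_setX//; last exact: measurable_tuple_box mXS.
rewrite [LHS]/=; congr (cons_measure _ _); apply/seteqP; split=> t.
  move=> Xt; split=> [|i]; first exact: Xt.
  by have := Xt (lift ord0 i); rewrite [in tnth t _](tuple_eta t) tnthS.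
move=> [/= X0 XS] i; case: (unliftP ord0 i) => [j|] -> //.
by rewrite [in tnth t _](tuple_eta t) tnthS.
Qed.

End PowerMeasure.

(** * Volume as a measure *)

Section RowTopology.
Variables (R : realFieldType) (n : nat).
Implicit Types (x : 'rV[R]_n).

Lemma ler_coord_norm x i : `|x 0 i| <= `|x|.
Proof.
by rewrite [leRHS]/Num.norm /= mx_normrE; apply/bigmax_geP; right; exists (0, i).
Qed.

Lemma row_norm_le x (e : R) : 0 <= e -> (forall i, `|x 0 i| <= e) -> `|x| <= e.
Proof.
move=> e0 xe; rewrite [leLHS]/Num.norm /= mx_normrE.
by apply/bigmax_leP; split=> // -[j i] _ /=; rewrite ord1.
Qed.

Lemma continuous_rV (T : topologicalType) (f : T -> 'rV[R]_n) :
  (forall i, continuous (fun t => f t 0 i)) -> continuous f.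
Proof.
move=> cf t; apply/cvgrPdist_le => e e0.
have : \forall s \near t, forall i, `|f t 0 i - f s 0 i| <= e.
  by apply: filter_forall => i; have /cvgrPdist_le := cf i t; exact.
apply: filterS => s fs; apply: row_norm_le (ltW e0) _ => i.
by rewrite !mxE.
Qed.

End RowTopology.

Lemma closed_mem_approx (R : numFieldType) (V : normedModType R) (A : set V) x :
  closed A -> (forall e : R, 0 < e -> exists2 a, A a & `|x - a| < e) -> A x.
Proof.
move=> clA Ax; apply: clA => B /nbhs_normP[e /= /Ax[a Aa xa] eB].
by exists a; split=> //; exact: eB.
Qed.

Section VolumeAsMeasure.
Variable R : realType.
Notation T n := (n.-tuple (measurableTypeR R)).
Notation lambda := (@lebesgue_measure R).
Notation leb := (power_measure lambda).

Definition row_of_tuple n (t : T n) : 'rV[R]_n := \row_i tnth t i.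

Definition row_measurable n (A : set 'rV[R]_n) := measurable (@row_of_tuple n @^-1` A).

Definition row_leb n (A : set 'rV[R]_n) : \bar R := leb n (@row_of_tuple n @^-1` A).

Section Products.
Variables (n : nat) (X : 'I_n -> interval R) (A : set 'rV[R]_n).
Hypothesis AX : forall x, A x <-> forall i, x 0 i \in X i.

Let preimageE : @row_of_tuple n @^-1` A = [set t | forall i, [set` X i] (tnth t i)].
Proof. by apply/seteqP; split=> t /=; rewrite AX => tX i; have := tX i; rewrite mxE. Qed.

Let mX i : measurable ([set` X i] : set (measurableTypeR R)).
Proof. exact: measurable_itv. Qed.

Lemma row_measurable_prod : row_measurable A.
Proof. by rewrite /row_measurable preimageE; exact: measurable_tuple_box mX. Qed.

Lemma row_leb_prod : row_leb A = (\prod_(i < n) lambda [set` X i])%E.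
Proof. by rewrite /row_leb preimageE; exact: power_measure_box mX. Qed.

End Products.

Lemma lebesgue_measure_segment (a b : R) : a <= b -> lambda `[a, b]%classic = (b - a)%:E.
Proof.
rewrite le_eqVlt lebesgue_measure_itv /= lte_fin => /predU1P[->|->]; last by rewrite EFinB.
by rewrite ltxx subrr.
Qed.

Lemma boxP n (a b x : 'rV[R]_n) : box a b x <-> forall i, x 0 i \in `[a 0 i, b 0 i].
Proof. by split=> xab i; have := xab i; rewrite in_itv. Qed.

Lemma row_measurable_box n (a b : 'rV[R]_n) : row_measurable (box a b).
Proof. exact: row_measurable_prod (boxP a b). Qed.

Lemma row_leb_box n (a b : 'rV[R]_n) : (forall i, a 0 i <= b 0 i) ->
  row_leb (box a b) = (box_vol a b)%:E.
Proof.
move=> ab; rewrite (row_leb_prod (boxP a b)) /box_vol -prodEFin.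
by apply: eq_bigr => i _; exact: lebesgue_measure_segment.
Qed.

Lemma box_vol_ge0 n (a b : 'rV[R]_n) : (forall i, a 0 i <= b 0 i) -> 0 <= box_vol a b.
Proof. by move=> ab; apply: prodr_ge0 => i _; rewrite subr_ge0. Qed.

Lemma row_leb_le_vol n (A : set 'rV[R]_n) : row_measurable A -> (row_leb A <= vol A)%E.
Proof.
move=> mA; apply: le_ereal_inf_tmp => _ [a [b [ab Aab ->]]].
rewrite (eq_eseriesr (g := fun k => row_leb (box (a k) (b k)))); last first.
  by move=> k _; rewrite row_leb_box.
apply: measure_sigma_subadditive => //.
- by move=> k; exact: row_measurable_box.
- by move=> t /Aab[k _ ?]; exists k.
Qed.

(* In dimension 0 every box has volume 1, so the cover cannot be padded with
   boxes of volume 0. *)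
Lemma vol_le_esum_box n (I : countType) (D : set I) (a b : I -> 'rV[R]_n.+1)
    (A : set 'rV[R]_n.+1) :
  (forall i j, a i 0 j <= b i 0 j) -> A `<=` \bigcup_(i in D) box (a i) (b i) ->
  (vol A <= \esum_(i in D) (box_vol (a i) (b i))%:E)%E.
Proof.
move=> ab Aab; pose pad (f : I -> 'rV[R]_n.+1) k :=
  if k \in pickle @` D then oapp f 0 (pickle_inv k) else 0.
have padE f i : D i -> pad f (pickle i) = f i.
  by move=> Di; rewrite /pad pickleK_inv mem_set//; exists i.
have padN f k : k \notin pickle @` D -> pad f k = 0 by rewrite /pad => /negPf ->.
have vol00 : box_vol 0 (0 : 'rV[R]_n.+1) = 0.
  by rewrite /box_vol big_ord_recl mxE subrr mul0r.
have pad_le k j : pad a k 0 j <= pad b k 0 j.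
  by rewrite /pad; case: ifP => // _; case: pickle_inv => //=.
apply: ereal_inf_lbound; exists (pad a), (pad b); split=> //.
  move=> x /Aab[i Di xi]; exists (pickle i) => //.
  by rewrite /box !padE.
rewrite nneseries_esumT => [|k]; last by rewrite lee_fin box_vol_ge0.
rewrite -(eq_esum (fun i Di => congr2 (fun x y => (box_vol x y)%:E) (padE a i Di) (padE b i Di))).
rewrite -(esum_image D pickle (fun k => (box_vol (pad a k) (pad b k))%:E)); last first.
  by apply: in2W; exact: pcan_inj pickleK_inv.
rewrite esum_mkcond; apply: eq_esum => k _; case: ifPn => // kD.
by rewrite !padN// vol00.
Qed.

End VolumeAsMeasure.

Lemma esum_measure_le d (T : measurableType d) (R : realType)
    (mu : {measure set T -> \bar R}) (I : choiceType) (D : set I) (F : I -> set T) :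
  (forall i, measurable (F i)) -> trivIset D F ->
  measurable (\bigcup_(i in D) F i) ->
  (\esum_(i in D) mu (F i) <= mu (\bigcup_(i in D) F i))%E.
Proof.
move=> mF tF mDF; apply: ge_ereal_sup => _ [X [finX XD] <-].
rewrite -measure_fin_bigcup//; last exact: sub_trivIset tF.
apply: le_measure; rewrite ?inE//; last exact: bigcup_subset.
exact: fin_bigcup_measurable.
Qed.

Section Grid.
Variables (R : realType) (n : nat).
Implicit Types (s : R) (x y : 'rV[R]_n) (A : set 'rV[R]_n) (f : {ffun 'I_n -> int}).

Definition grid_index s x : {ffun 'I_n -> int} := [ffun i => Num.floor (s * x 0 i)].

Definition grid_cell s f : set 'rV[R]_n := grid_index s @^-1` [set f].

Definition grid_hull s A : set 'rV[R]_n := grid_index s @^-1` (grid_index s @` A).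

Lemma grid_hullE s A :
  grid_hull s A = \bigcup_(f in grid_index s @` A) grid_cell s f.
Proof. by apply/seteqP; split=> x; [exists (grid_index s x) | move=> [_ /[swap] <-]]. Qed.

Lemma grid_cellP s f x : 0 < s ->
  grid_cell s f x <-> forall i, x 0 i \in `[(f i)%:~R / s, (f i + 1)%:~R / s[.
Proof.
move=> s0; have floorP i :
    (Num.floor (s * x 0 i) == f i) = (x 0 i \in `[(f i)%:~R / s, (f i + 1)%:~R / s[).
  by rewrite floor_eq in_itv /= ler_pdivrMr// ltr_pdivlMr// mulrC.
split=> [xf i|xf]; first by rewrite -floorP -xf ffunE.
by apply/ffunP => i; rewrite ffunE; apply/eqP; rewrite floorP.
Qed.

Lemma row_measurable_grid_cell s f : 0 < s -> row_measurable (grid_cell s f).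
Proof. by move=> s0; exact: row_measurable_prod (fun x => grid_cellP f x s0). Qed.

Lemma row_leb_grid_cell s f : 0 < s -> row_leb (grid_cell s f) = (s^-1 ^+ n)%:E.
Proof.
move=> s0; rewrite (row_leb_prod (fun x => grid_cellP f x s0)).
rewrite (eq_bigr (fun=> (s^-1)%:E)) => [|i _]; first by rewrite prodEFin prodr_const card_ord.
rewrite lebesgue_measure_itv /= lte_fin ltr_pM2r ?invr_gt0// ltr_int ltzD1 lexx.
by rewrite -EFinB -mulrBl -intrB addrAC subrr add0r mul1r.
Qed.

Lemma row_measurable_grid_hull s A : 0 < s -> row_measurable (grid_hull s A).
Proof.
move=> s0; rewrite /row_measurable grid_hullE preimage_bigcup bigcup_mkcond.
apply: countable_bigcupT_measurable => // f; case: ifP => // _.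
exact: row_measurable_grid_cell.
Qed.

Lemma grid_hull_nonincreasing s A : grid_hull (2 * s) A `<=` grid_hull s A.
Proof.
move=> x [a Aa xa]; exists a => //; apply/ffunP => i; rewrite !ffunE.
have le_floor (k : int) (z : R) : (k <= Num.floor z) = (2 * k <= Num.floor (2 * z)).
  by rewrite !floor_ge_int intrM ler_pM2l.
have floor2 : Num.floor (2 * (s * a 0 i)) = Num.floor (2 * (s * x 0 i)).
  by have /ffunP/(_ i) := xa; rewrite !ffunE !mulrA.
have same_minorants k : (k <= Num.floor (s * a 0 i)) = (k <= Num.floor (s * x 0 i)).
  by rewrite le_floor floor2 -le_floor.
by apply/eqP; rewrite eq_le -same_minorants lexx same_minorants lexx.
Qed.

Lemma grid_index_dist s x y : 0 < s -> grid_index s x = grid_index s y ->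
  `|x - y| <= s^-1.
Proof.
move=> s0 /ffunP xy; apply: row_norm_le => [|i]; first by rewrite invr_ge0 ltW.
have := xy i; rewrite !mxE !ffunE => floor_xy.
have := floor_itv (s * y 0 i); rewrite -floor_xy => ys.
have := floor_itv (s * x 0 i); move: ys; rewrite intrD => /andP[y1 y2] /andP[x1 x2].
rewrite -(ler_pM2l s0) divff ?gt_eqF// -{1}(gtr0_norm s0) -normrM mulrBr ler_norml.
lra.
Qed.

Lemma bigcap_grid_hull A : compact A -> \bigcap_k grid_hull (2 ^+ k) A = A.
Proof.
move=> coA; apply/seteqP; split=> x Ax; last by move=> k _; exists x.
apply: closed_mem_approx (compact_closed (@norm_hausdorff _ _) coA) _ => e e0.
have [k _ /(_ k (leqnn k)) ke] := near_infty_natSinv_expn_lt (PosNum e0).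
have [a Aa ax] := Ax k I; exists a => //; rewrite div1r in ke.
by apply: le_lt_trans ke; apply: grid_index_dist; rewrite ?exprn_gt0.
Qed.

Lemma grid_hull_sub_box A : compact A ->
  exists2 M : R, 0 <= M & grid_hull 1 A `<=` box (const_mx (- M)) (const_mx M).
Proof.
move=> /compact_bounded[M0 [_ AM0]]; pose M := Num.max (M0 + 1) 0.
have AM a : A a -> `|a| <= M.
  by move=> Aa; apply: AM0 => //; rewrite lt_max ltrDl ltr01.
have M_ge0 : 0 <= M by rewrite le_max lexx orbT.
exists (M + 1) => [|x [a /AM aM xa] i]; rewrite ?mxE; first lra.
have := grid_index_dist ltr01 (esym xa); rewrite invr1 => ax.
have := ler_coord_norm (x - a) i; have := ler_coord_norm a i; rewrite !mxE -ler_norml.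
have := ler_normD (x 0 i - a 0 i) (a 0 i); rewrite subrK; lra.
Qed.

End Grid.

Lemma vol_le_grid_hull (R : realType) n (s : R) (A : set 'rV[R]_n.+1) : 0 < s ->
  (vol A <= row_leb (grid_hull s A))%E.
Proof.
move=> s0; pose corner k (f : {ffun 'I_n.+1 -> int}) : 'rV[R]_n.+1 :=
  \row_i ((f i + k)%:~R / s).
have cell_box f : grid_cell s f `<=` box (corner 0 f) (corner 1 f).
  move=> x /(grid_cellP _ _ s0) xf i; rewrite !mxE addr0.
  by have := xf i; rewrite in_itv /= => /andP[-> /ltW].
have box_volE f : (box_vol (corner 0 f) (corner 1 f))%:E = row_leb (grid_cell s f).
  rewrite row_leb_grid_cell// /box_vol (eq_bigr (fun=> s^-1)) => [|i _].
    by rewrite prodr_const card_ord.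
  by rewrite !mxE -mulrBl -intrB opprD addrACA subrr add0r subr0 mul1r.
apply: (@le_trans _ _ (\esum_(f in grid_index s @` A) row_leb (grid_cell s f))%E).
  rewrite -(eq_esum (fun f _ => box_volE f)); apply: vol_le_esum_box.
    by move=> f i; rewrite !mxE ler_pM2r ?invr_gt0// ler_int lerD2l.
  move=> x Ax; exists (grid_index s x); first by exists x.
  exact: cell_box.
rewrite /row_leb grid_hullE preimage_bigcup; apply: esum_measure_le.
- by move=> f; exact: row_measurable_grid_cell.
- by move=> f g _ _ [t [<- <-]].
- by rewrite -preimage_bigcup -grid_hullE; exact: row_measurable_grid_hull.
Qed.

Section VolumeOfCompact.
Variables (R : realType) (n : nat).
Implicit Types A : set 'rV[R]_n.+1.

Lemma row_measurable_compact A : compact A -> row_measurable A.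
Proof.
move=> coA; rewrite /row_measurable -(bigcap_grid_hull coA) preimage_bigcap.
by apply: bigcapT_measurable => k; apply: row_measurable_grid_hull; rewrite exprn_gt0.
Qed.

Lemma row_leb_grid_hull_lty A : compact A -> (row_leb (grid_hull 1 A) < +oo)%E.
Proof.
move=> /grid_hull_sub_box[M M0 hullM].
apply: le_lt_trans (ltry (box_vol (const_mx (- M) : 'rV[R]_n.+1) (const_mx M))).
rewrite -row_leb_box => [|i]; last by rewrite !mxE; lra.
apply: le_measure; rewrite ?inE.
- exact: row_measurable_grid_hull.
- exact: row_measurable_box.
- by move=> t; exact: hullM.
Qed.

Lemma row_leb_compact A : compact A -> row_leb A = vol A.
Proof.
move=> coA; have mA := row_measurable_compact coA.
apply/eqP; rewrite eq_le row_leb_le_vol//=.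
pose hull k := @row_of_tuple R n.+1 @^-1` grid_hull (2 ^+ k) A.
have hullA : \bigcap_k hull k = @row_of_tuple R n.+1 @^-1` A.
  by rewrite -preimage_bigcap bigcap_grid_hull.
have cvg_hull :
    (power_measure lebesgue_measure n.+1 \o hull) k @[k --> \oo] --> row_leb A.
  rewrite /row_leb -hullA; apply: nonincreasing_cvg_mu.
  - exact: row_leb_grid_hull_lty.
  - by move=> k; apply: row_measurable_grid_hull; rewrite exprn_gt0.
  - by rewrite hullA.
  - apply/nonincreasing_seqP => k; apply/subsetPset => t; rewrite /hull exprS.
    exact: grid_hull_nonincreasing.
apply: cvge_to_ge cvg_hull _; near=> k.
by apply: vol_le_grid_hull; rewrite exprn_gt0.
Unshelve. all: by end_near. Qed.

Lemma vol_compact_fin_num A : compact A -> vol A \is a fin_num.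
Proof.
move=> coA; rewrite -row_leb_compact// ge0_fin_numE//.
apply: le_lt_trans (row_leb_grid_hull_lty coA); apply: le_measure; rewrite ?inE.
- exact: row_measurable_compact.
- exact: row_measurable_grid_hull.
- by move=> t At; exists (row_of_tuple t).
Qed.

End VolumeOfCompact.

Section VolumeMonotone.
Variables (R : realType) (n : nat).
Implicit Types A B : set 'rV[R]_n.

Lemma vol_mono A B : A `<=` B -> (vol A <= vol B)%E.
Proof.
move=> AB; apply: le_ereal_inf => _ [a [b [ab Bab ->]]].
by exists a, b; split=> //; exact: subset_trans Bab.
Qed.

Lemma vol_ge0 A : (0 <= vol A)%E.
Proof.
apply: le_ereal_inf_tmp => _ [a [b [ab _ ->]]]; apply: nneseries_ge0 => k _ _.
by rewrite lee_fin box_vol_ge0.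
Qed.

Lemma vol_gt0 A : interior A !=set0 -> (0 < vol A)%E.
Proof.
move=> [x /nbhs_normP[e /= e0 eA]]; pose r := const_mx (e / 2) : 'rV[R]_n.
have r_le i : (x - r) 0 i <= (x + r) 0 i by rewrite !mxE; lra.
have boxA : box (x - r) (x + r) `<=` A.
  move=> y xy; apply: eA => /=; apply: (@le_lt_trans _ _ (e / 2)); last lra.
  by apply: row_norm_le => [|i]; [lra | have := xy i; rewrite !mxE ler_norml; lra].
apply: lt_le_trans (vol_mono boxA).
apply: lt_le_trans (row_leb_le_vol (row_measurable_box _ _)); rewrite row_leb_box// lte_fin.
by apply: prodr_gt0 => i _; rewrite !mxE; lra.
Qed.

End VolumeMonotone.

Section VolumeImage.
Variables (R : realType) (n : nat).
Implicit Types (f g : 'rV[R]_n -> 'rV[R]_n) (A B : set 'rV[R]_n).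

Definition rV_le (a b : 'rV[R]_n) := forall i, a 0 i <= b 0 i.

Lemma vol_image_le f (c : R) A : 0 < c -> {homo f : a b / rV_le a b} ->
  (forall a b, box_vol (f a) (f b) = c * box_vol a b) ->
  (vol (f @` A) <= c%:E * vol A)%E.
Proof.
move=> c0 f_homo f_vol; rewrite -lee_pdivrMl//.
apply: le_ereal_inf_tmp => _ [a [b [ab Aab ->]]]; rewrite lee_pdivrMl//.
apply: ereal_inf_lbound; exists (f \o a), (f \o b); split=> [k|_ [x Ax <-]|].
- by apply: f_homo => i; exact: ab.
- have [k _ xab] := Aab _ Ax; exists k => // i.
  have [ax xb] : rV_le (a k) x /\ rV_le x (b k) by split=> j; case/andP: (xab j).
  by rewrite !f_homo.
- rewrite -nneseriesZl => [|k _]; last by rewrite lee_fin box_vol_ge0.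
  by apply: eq_eseriesr => k _; rewrite /= f_vol EFinM.
Qed.

Lemma vol_image f g (c : R) A : 0 < c -> cancel f g ->
  (forall B, (vol (f @` B) <= c%:E * vol B)%E) ->
  (forall B, (vol (g @` B) <= (c^-1)%:E * vol B)%E) ->
  vol (f @` A) = (c%:E * vol A)%E.
Proof.
move=> c0 fK vol_f vol_g; apply/eqP; rewrite eq_le vol_f/= -lee_pdivlMl//.
by have := vol_g (f @` A); rewrite image_comp (_ : g \o f = id) ?image_id//; apply/funext.
Qed.

Lemma vol_translate (w : 'rV[R]_n) A : vol ((fun x => x + w) @` A) = vol A.
Proof.
have vol_le (v : 'rV[R]_n) B : (vol ((fun x => (x + v)%R) @` B) <= 1%:E * vol B)%E.
  apply: vol_image_le => // [a b ab|a b]; first by move=> i; rewrite !mxE lerD2r ab.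
  by rewrite mul1r; apply: eq_bigr => i _; rewrite !mxE; ring.
rewrite (vol_image A ltr01 (addrK w)) ?mul1e// => B.
by rewrite invr1; exact: vol_le.
Qed.

Lemma vol_scale (c : R) A : 0 < c -> vol ( *:%R c @` A) = ((c ^+ n)%:E * vol A)%E.
Proof.
have vol_le (d : R) B : 0 < d -> (vol ( *:%R d @` B) <= (d ^+ n)%:E * vol B)%E.
  move=> d0; apply: vol_image_le => [|a b ab|a b]; first exact: exprn_gt0.
    by move=> i; rewrite !mxE ler_pM2l.
  rewrite /box_vol (eq_bigr (fun i => d * (b 0 i - a 0 i))) => [|i _].
    by rewrite big_split /= prodr_const card_ord.
  by rewrite !mxE mulrBr.
move=> c0; apply: (vol_image A (g := *:%R c^-1)) => [|x|B|B]; first exact: exprn_gt0.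
- by rewrite scalerA mulVf ?gt_eqF// scale1r.
- exact: vol_le.
- by rewrite -exprVn; apply: vol_le; rewrite invr_gt0.
Qed.

Lemma vol_col_perm (s : 'S_n) A : vol (col_perm s @` A) = vol A.
Proof.
have vol_le (p : 'S_n) B : (vol (col_perm p @` B) <= 1%:E * vol B)%E.
  apply: vol_image_le => // [a b ab|a b]; first by move=> i; rewrite !mxE.
  rewrite mul1r /box_vol [RHS](reindex_inj (@perm_inj _ p)) /=.
  by apply: eq_bigr => i _; rewrite !mxE.
rewrite (vol_image (g := col_perm s^-1) A ltr01) ?mul1e// => [x|B].
  by rewrite -col_permM mulVg col_perm1.
by rewrite invr1; exact: vol_le.
Qed.

End VolumeImage.

Lemma image_can2 (aT rT : Type) (f : aT -> rT) (g : rT -> aT) (A : set aT) :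
  cancel f g -> cancel g f -> f @` A = g @^-1` A.
Proof.
move=> fK gK; apply/seteqP; split=> [_ [x Ax <-]|y Ay]; first by rewrite /= fK.
by exists (g y).
Qed.

Lemma compact_image (T U : topologicalType) (f : T -> U) (A : set T) :
  continuous f -> compact A -> compact (f @` A).
Proof. by move=> cf; apply: continuous_compact; exact: continuous_subspaceT. Qed.

Lemma continuous_translate (R : numFieldType) (V : normedModType R) (w : V) :
  continuous (fun x : V => x + w).
Proof. by move=> x; apply: cvgD; [exact: cvg_id | exact: cvg_cst]. Qed.

Lemma continuous_addZ (R : numFieldType) (T : topologicalType) (V : normedModType R)
    (f : T -> V) (h : T -> R) (w : V) :
  continuous f -> continuous h -> continuous (fun x => f x + h x *: w).
Proof.
move=> cf ch x; apply: cvgD; first exact: cf.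
by apply: cvgZ; [exact: ch | exact: cvg_cst].
Qed.

Section Slices.
Variables (R : realType) (n : nat).
Implicit Types (s : R) (y : 'rV[R]_n) (x w : 'rV[R]_n.+1) (A : set 'rV[R]_n.+1).

Definition cons_row s y : 'rV[R]_n.+1 := \row_i oapp (y 0) s (unlift ord0 i).

Lemma cons_row0 s y : cons_row s y 0 0 = s.
Proof. by rewrite mxE unlift_none. Qed.

Lemma cons_rowS s y i : cons_row s y 0 (lift ord0 i) = y 0 i.
Proof. by rewrite mxE liftK. Qed.

Lemma cons_row_eta x : cons_row (x 0 0) (col' 0 x) = x.
Proof.
apply/rowP => i; case: (unliftP ord0 i) => [j|] ->; first by rewrite cons_rowS mxE.
by rewrite cons_row0.
Qed.

Lemma cons_rowK s y : col' 0 (cons_row s y) = y.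
Proof. by apply/rowP => i; rewrite mxE cons_rowS. Qed.

Lemma row_of_tuple_cons s (t : n.-tuple (measurableTypeR R)) :
  row_of_tuple (cons_pair (s : measurableTypeR R, t)) = cons_row s (row_of_tuple t).
Proof.
apply/rowP => i; case: (unliftP ord0 i) => [j|] ->; last by rewrite cons_row0 mxE.
by rewrite cons_rowS !mxE tnthS.
Qed.

Definition slice s A : set 'rV[R]_n := [set y | A (cons_row s y)].

Lemma row_leb_integral_slice A : row_measurable A ->
  row_leb A = (\int[@lebesgue_measure R]_s row_leb (slice s A))%E.
Proof.
move=> mA; rewrite /row_leb power_measure_integral_head//; apply: eq_integral => s _.
by congr (power_measure _ _ _); apply/seteqP; split=> t; rewrite /slice /= row_of_tuple_cons.
Qed.

Lemma compact_slice s A : compact A -> compact (slice s A).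
Proof.
move=> coA; have -> : slice s A = col' 0 @` (A `&` [set x | x 0 0 = s]).
  apply/seteqP; split=> [y Ay|_ [x [Ax <-] <-]]; last by rewrite /slice /= cons_row_eta.
  by exists (cons_row s y); rewrite ?cons_rowK//=; split=> //; rewrite cons_row0.
apply: compact_image.
  apply: continuous_rV => i; under eq_fun do rewrite mxE.
  exact: coord_continuous.
apply: compact_closedI => //.
by apply: (closed_comp _ (@closed_eq R s)) => x _; exact: coord_continuous.
Qed.

Definition shear w x := x + x 0 0 *: w.

Lemma shearK w : w 0 0 = 0 -> cancel (shear w) (shear (- w)).
Proof. by move=> w0 x; rewrite /shear !mxE w0 mulr0 addr0 scalerN addrK. Qed.

Lemma shearNK w : w 0 0 = 0 -> cancel (shear (- w)) (shear w).
Proof. by move=> w0; rewrite -{2}[w]opprK; apply: shearK; rewrite mxE w0 oppr0. Qed.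

Lemma shear_image w A : w 0 0 = 0 -> shear w @` A = shear (- w) @^-1` A.
Proof. by move=> w0; apply: image_can2; [exact: shearK | exact: shearNK]. Qed.

Lemma compact_shear w A : compact A -> compact (shear w @` A).
Proof.
apply: compact_image; apply: continuous_addZ; last exact: coord_continuous.
by move=> x; exact: cvg_id.
Qed.

Lemma slice_shear s w A : w 0 0 = 0 ->
  slice s (shear w @` A) = (fun y => y + s *: col' 0 w) @` slice s A.
Proof.
move=> w0; rewrite shear_image// (image_can2 _ (addrK _) (subrK _)).
apply/funext => y; rewrite /slice /preimage /mkset /shear cons_row0; congr A.
apply/rowP => i; case: (unliftP ord0 i) => [j|] ->.
  by rewrite mxE !cons_rowS !mxE mulrN.
by rewrite mxE !cons_row0 !mxE w0 oppr0 mulr0 addr0.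
Qed.

End Slices.

Lemma row_leb_translate (R : realType) n (v : 'rV[R]_n) (A : set 'rV[R]_n) : compact A ->
  row_leb ((fun x => x + v) @` A) = row_leb A.
Proof.
case: n v A => [|n] v A coA.
  rewrite (_ : (fun x => x + v) = id) ?image_id//; apply/funext => x.
  by rewrite (thinmx0 v) addr0.
rewrite !row_leb_compact ?vol_translate//.
by apply: compact_image coA; exact: continuous_translate.
Qed.

Lemma vol_shear (R : realType) n (w : 'rV[R]_n.+1) (A : set 'rV[R]_n.+1) :
  w 0 0 = 0 -> compact A -> vol (shear w @` A) = vol A.
Proof.
move=> w0 coA; have coA' : compact (shear w @` A) by exact: compact_shear.
rewrite -!row_leb_compact// !row_leb_integral_slice; try exact: row_measurable_compact.
apply: eq_integral => s _; rewrite slice_shear//.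
by apply: row_leb_translate; exact: compact_slice.
Qed.

(** * Cavalieri's principle along a direction *)

Section LebesgueLength.
Variable R : realType.
Notation lambda := (@lebesgue_measure R).
Implicit Types F : set (measurableTypeR R).

Lemma lebesgue_measure_interval_ge F (s t : R) : is_interval F -> F s -> F t ->
  (`|t - s|%:E <= lambda F)%E.
Proof.
move=> iF; wlog st : s t / s <= t.
  move=> le_st Fs Ft; have [st|/ltW ts] := leP s t; first exact: le_st.
  by rewrite distrC; exact: le_st.
move=> Fs Ft; rewrite ger0_norm ?subr_ge0// -lebesgue_measure_segment//.
apply: le_measure; rewrite ?inE.
- exact: measurable_itv.
- exact: is_interval_measurable.
- by move=> z /=; rewrite in_itv; exact: iF.
Qed.

Lemma lebesgue_measure_le_diam F (M : \bar R) : measurable F -> (0 <= M)%E ->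
  (forall s t, F s -> F t -> s <= t -> ((t - s)%:E <= M)%E) -> (lambda F <= M)%E.
Proof.
move=> mF M0 FM; have [->|/set0P[s0 Fs0]] := eqVneq F set0; first by rewrite measure0.
case: M M0 FM => [M M0 FM|_ _|//]; last by rewrite leey.
rewrite lee_fin in M0.
have ubF s t : F s -> F t -> t <= s + M.
  move=> Fs Ft; rewrite -lerBlDl; have [st|/ltW ts] := leP s t.
    by have := FM _ _ Fs Ft st; rewrite lee_fin.
  by apply: le_trans M0; rewrite subr_le0.
have supF : has_sup F by split; [exists s0 | exists (s0 + M) => t; exact: ubF].
have F_sub : F `<=` `[sup F - M, sup F]%classic.
  move=> t Ft /=; rewrite in_itv /=; apply/andP; split; last exact: sup_upper_bound.
  by rewrite lerBlDr; apply: ge_sup => [|s Fs]; [exists s0 | exact: ubF].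
have -> : M%:E = lambda `[sup F - M, sup F]%classic.
  by rewrite lebesgue_measure_segment ?lerBlDr ?lerDl// opprB addrC subrK.
by apply: le_measure; rewrite ?inE//; exact: measurable_itv.
Qed.

End LebesgueLength.

Section Chords.
Variables (R : realType) (n : nat).
Implicit Types (u x : 'rV[R]_n) (A : set 'rV[R]_n).

Definition chord A u x : set (measurableTypeR R) := [set t | A (x + t *: u)].

Lemma measurable_chord A u x : compact A -> measurable (chord A u x).
Proof.
move=> /(compact_closed (@norm_hausdorff _ _)) clA; apply: closed_measurable.
apply: (closed_comp _ clA) => t _; apply: (@continuous_addZ R R).
  by move=> ?; exact: cvg_cst.
by move=> ?; exact: cvg_id.
Qed.

Lemma is_interval_chord A u x : convex_set A -> is_interval (chord A u x).
Proof.
move=> cA s t As At z /andP[sz zt].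
have [est|nst] := eqVneq s t.
  by rewrite (_ : z = s)//; apply/eqP; rewrite eq_le sz est zt.
have d0 : 0 < t - s by rewrite subr_gt0 lt_neqAle nst (le_trans sz zt).
have := cA _ _ ((z - s) / (t - s)) At As.
rewrite divr_ge0 ?subr_ge0 ?(le_trans sz zt)//.
rewrite ler_pdivrMr// mul1r lerD2r zt => /(_ erefl erefl).
rewrite /chord /=; congr A; apply/rowP => i; rewrite !mxE; field.
by rewrite gt_eqF.
Qed.

Lemma chord_image A u x (f g : 'rV[R]_n -> 'rV[R]_n) : cancel f g -> cancel g f ->
  (forall y t, f (y + t *: u) = f y + t *: f u) ->
  chord (f @` A) (f u) x = chord A u (g x).
Proof.
move=> fK gK f_affine; rewrite /chord (image_can2 _ fK gK); apply/funext => t.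
by rewrite /mkset /preimage /mkset -{1}[x]gK -f_affine fK.
Qed.

End Chords.

Section Cavalieri.
Variables (R : realType) (n : nat).
Notation lambda := (@lebesgue_measure R).
Notation leb := (power_measure lambda).
Notation V := 'rV[R]_n.+1.
Implicit Types (u x : V) (A B C : set V).

Definition cavalieri_along u := forall A B C, compact A -> compact B -> compact C ->
  (forall x, (2%:E * lambda (chord A u x) <= lambda (chord B u x) + lambda (chord C u x))%E) ->
  (2%:E * vol A <= vol B + vol C)%E.

Lemma chord_delta0 A (y : n.-tuple (measurableTypeR R)) :
  chord A (delta_mx 0 0) (cons_row 0 (row_of_tuple y)) =
  [set s | A (row_of_tuple (cons_pair (s, y)))].
Proof.
apply/funext => s; rewrite /chord /mkset row_of_tuple_cons; congr A.
apply/rowP => i; case: (unliftP ord0 i) => [j|] ->; rewrite mxE.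
  by rewrite !cons_rowS !mxE mulr0 addr0.
by rewrite !cons_row0 !mxE mulr1 add0r.
Qed.

Lemma measurable_chord_delta0 A : compact A ->
  measurable_fun setT (fun y : n.-tuple (measurableTypeR R) =>
    lambda (chord A (delta_mx 0 0) (cons_row 0 (row_of_tuple y)))).
Proof.
move=> /row_measurable_compact /(measurable_fun_head_section lambda).
by congr (measurable_fun _ _); apply/funext => y; rewrite chord_delta0.
Qed.

Lemma vol_integral_chord_delta0 A : compact A ->
  vol A = (\int[leb n]_y lambda (chord A (delta_mx 0%R 0%R) (cons_row 0%R (row_of_tuple y))))%E.
Proof.
move=> coA; rewrite -row_leb_compact// /row_leb power_measure_integral_behead; last first.
  exact: row_measurable_compact.
by apply: eq_integral => y _; rewrite chord_delta0.
Qed.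

Lemma cavalieri_along_delta0 : cavalieri_along (delta_mx 0 0).
Proof.
move=> A B C coA coB coC chord_le; rewrite !vol_integral_chord_delta0//.
have mchord D : compact D -> measurable_fun setT (fun y : n.-tuple (measurableTypeR R) =>
  lambda (chord D (delta_mx 0 0) (cons_row 0 (row_of_tuple y)))).
  exact: measurable_chord_delta0.
rewrite -ge0_integralZl// -?ge0_integralD//; try exact: mchord.
apply: ge0_le_integral => // [y _||].
- by rewrite mule_ge0.
- by apply: measurable_funeM; exact: mchord.
- by apply: emeasurable_funD; exact: mchord.
Qed.

Lemma cavalieri_along_image u (f g : V -> V) : cancel f g -> cancel g f ->
  (forall y t, f (y + t *: u) = f y + t *: f u) ->
  (forall A, compact A -> compact (f @` A)) ->
  (forall A, compact A -> vol (f @` A) = vol A) ->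
  cavalieri_along (f u) -> cavalieri_along u.
Proof.
move=> fK gK f_affine co_f vol_f cav A B C coA coB coC chord_le.
rewrite -(vol_f A)// -(vol_f B)// -(vol_f C)//.
by apply: cav => [|||x]; [exact: co_f..|rewrite !(chord_image _ _ fK gK)].
Qed.

Lemma cavalieri_along_head u : u 0 0 = 1 -> cavalieri_along u.
Proof.
move=> u0; pose w : V := delta_mx 0 0 - u.
have w0 : w 0 0 = 0 by rewrite !mxE u0 subrr.
apply: (cavalieri_along_image (shearK w0) (shearNK w0)).
- move=> y t; apply/rowP => i; rewrite /shear !mxE u0; ring.
- by move=> A; exact: compact_shear.
- by move=> A; exact: vol_shear.
rewrite (_ : shear w u = delta_mx 0 0); first exact: cavalieri_along_delta0.
by rewrite /shear u0 scale1r /w addrC subrK.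
Qed.

Lemma cavalieri u j : u 0 j = 1 -> cavalieri_along u.
Proof.
move=> uj; have permK : involutive (@col_perm R 1 _ (tperm 0 j)).
  by move=> x; rewrite -col_permM tperm2 col_perm1.
apply: (cavalieri_along_image permK permK).
- by move=> y t; apply/rowP => i; rewrite !mxE.
- move=> A; apply: compact_image; apply: continuous_rV => i.
  by under eq_fun do rewrite mxE; exact: coord_continuous.
- by move=> A _; exact: vol_col_perm.
by apply: cavalieri_along_head; rewrite mxE tpermL.
Qed.

End Cavalieri.

(** * Convex hulls of finitely many points *)

Lemma continuous_sum (R : realType) (T : topologicalType) (V : normedModType R)
    (I : Type) (r : seq I) (F : I -> T -> V) :
  (forall i, continuous (F i)) -> continuous (fun x => \sum_(i <- r) F i x).
Proof. by move=> cF; apply: continuous_big => [|i _]; [exact: add_continuous | exact: cF]. Qed.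

Section ConvexHull.
Variables (R : realType) (n : nat).
Implicit Types (x y : 'rV[R]_n) (A P : set 'rV[R]_n).

Lemma sym_about0P A : sym_about 0 A <-> forall x, A x -> A (- x).
Proof. by split=> sA x /sA; rewrite scaler0 sub0r. Qed.

Lemma convex_midpoint A x y : convex_set A -> A x -> A y -> A (2^-1 *: (x + y)).
Proof.
move=> cA Ax Ay; rewrite scalerDr (_ : 2^-1 *: y = (1 - 2^-1) *: y).
  by apply: cA; rewrite ?invr_ge0// invf_le1// ler1n.
by congr (_ *: _); field.
Qed.

Lemma convex_comb A k (l : 'I_k -> R) (w : 'I_k -> 'rV[R]_n) :
  convex_set A -> (forall i, 0 <= l i) -> \sum_(i < k) l i = 1 ->
  (forall i, A (w i)) -> A (\sum_(i < k) l i *: w i).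
Proof.
move=> cA; elim: k l w => [|k IHk] l w l0 l1 Aw.
  by move: l1; rewrite big_ord0 => /esym/eqP; rewrite oner_eq0.
rewrite big_ord_recl; rewrite big_ord_recl in l1.
set r := \sum_(i < k) _ in l1.
have r0 : 0 <= r by apply: sumr_ge0.
have [rz|rn0] := eqVneq r 0.
  rewrite big1 ?addr0 => [|i _]; first by rewrite -[l ord0]addr0 -rz l1 scale1r.
  have /eqP := rz; rewrite psumr_eq0// => /allP/(_ i (mem_index_enum _)) /=.
  by move=> /eqP ->; rewrite scale0r.
have -> : \sum_(i < k) l (lift ord0 i) *: w (lift ord0 i) =
    (1 - l ord0) *: \sum_(i < k) (l (lift ord0 i) / r) *: w (lift ord0 i).
  rewrite scaler_sumr; apply: eq_bigr => i _; rewrite scalerA -l1 addrAC subrr add0r.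
  by rewrite mulrC divfK.
apply: cA => //; last by rewrite -l1 lerDl.
apply: IHk => // [i|]; first by rewrite divr_ge0.
by rewrite -mulr_suml divff.
Qed.

Lemma conv_hull_convex k (v : 'I_k -> 'rV[R]_n) : convex_set (conv_hull v).
Proof.
move=> x y t [l [l0 [l1 ->]]] [l' [l'0 [l'1 ->]]] t0 t1.
exists (fun i => t * l i + (1 - t) * l' i); split; last split.
- by move=> i; rewrite addr_ge0// mulr_ge0// subr_ge0.
- by rewrite big_split /= -!mulr_sumr l1 l'1; ring.
- rewrite !scaler_sumr -big_split /=; apply: eq_bigr => i _.
  by rewrite !scalerA -scalerDl.
Qed.

Lemma conv_hull_vertex k (v : 'I_k -> 'rV[R]_n) i : conv_hull v (v i).
Proof.
exists (fun j => (j == i)%:R); split; last split.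
- by move=> j; rewrite ler0n.
- by rewrite (bigD1 i) //= eqxx big1 ?addr0// => j /negPf ->.
- by rewrite (bigD1 i) //= eqxx scale1r big1 ?addr0// => j /negPf ->; rewrite scale0r.
Qed.

Lemma conv_hull_sub k (v : 'I_k -> 'rV[R]_n) A :
  convex_set A -> (forall i, A (v i)) -> conv_hull v `<=` A.
Proof. by move=> cA Av _ [l [l0 [l1 ->]]]; exact: convex_comb. Qed.

Lemma conv_hull_sym k (v : 'I_k -> 'rV[R]_n) :
  (forall i, exists j, v j = - v i) -> sym_about 0 (conv_hull v).
Proof.
move=> v_sym; apply/sym_about0P => _ [l [l0 [l1 ->]]]; rewrite -sumrN.
under eq_bigr do rewrite -scalerN.
apply: convex_comb => // [|i]; first exact: conv_hull_convex.
by have [j <-] := v_sym i; exact: conv_hull_vertex.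
Qed.

Definition simplex k : set 'rV[R]_k :=
  [set l | (forall i, 0 <= l 0 i) /\ \sum_i l 0 i = 1].
Arguments simplex : clear implicits.

Lemma conv_hullE k (v : 'I_k -> 'rV[R]_n) :
  conv_hull v = (fun l : 'rV[R]_k => \sum_i l 0 i *: v i) @` simplex k.
Proof.
apply/seteqP; split=> x; last by move=> [l [l0 l1] <-]; exists (fun i => l 0 i).
move=> [l [l0 [l1 ->]]]; exists (\row_i l i); last by apply: eq_bigr => i _; rewrite mxE.
by split=> [i|]; rewrite ?mxE// -l1; apply: eq_bigr => i _; rewrite mxE.
Qed.

Lemma compact_simplex k : compact (simplex k).
Proof.
apply: bounded_closed_compact.
  exists 1; split; first exact: num_real.
  move=> M M1 l [l0 l1]; apply: (le_trans _ (ltW M1)); apply: row_norm_le => // i.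
  by rewrite ger0_norm// -l1 (bigD1 i)//= lerDl sumr_ge0.
have -> : simplex k =
    (\bigcap_(i in [set: 'I_k]) ((fun l : 'rV[R]_k => l 0 i) @^-1` [set r | 0 <= r])) `&`
    (fun l : 'rV[R]_k => \sum_i l 0 i) @^-1` [set 1].
  by apply/seteqP; split=> l [l0 l1]; split=> // i *; exact: l0.
apply: closedI.
  apply: closed_bigI => i _; apply: closed_comp; last exact: closed_ge.
  by move=> x _; exact: coord_continuous.
apply: closed_comp; last exact: closed_eq.
by move=> x _; apply: (@continuous_sum R _ R) => i; exact: coord_continuous.
Qed.

Lemma compact_conv_hull k (v : 'I_k -> 'rV[R]_n) : compact (conv_hull v).
Proof.
rewrite conv_hullE; apply: compact_image; last exact: compact_simplex.
apply: continuous_sum => i x.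
by apply: continuousZ; [exact: coord_continuous | exact: cst_continuous].
Qed.

Lemma polytope_compact m P : polytope_le m P -> compact P.
Proof. by move=> [k [v [_ ->]]]; exact: compact_conv_hull. Qed.

Lemma conv_hull_drop k (v : 'I_k.+1 -> 'rV[R]_n) i (l : 'I_k.+1 -> R) :
  (forall j, 0 <= l j) -> \sum_j l j = 1 -> v i = \sum_j l j *: v j -> l i < 1 ->
  conv_hull v = conv_hull (v \o lift i).
Proof.
move=> l0 l1 vi li; apply/seteqP; split; last first.
  by apply: conv_hull_sub => [|j]; [exact: conv_hull_convex | exact: conv_hull_vertex].
apply: conv_hull_sub => [|j]; first exact: conv_hull_convex.
case: (unliftP i j) => [j'|] ->; first exact: (conv_hull_vertex (v \o lift i)).
have d0 : 0 < 1 - l i by rewrite subr_gt0.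
have sum_others : \sum_j l (lift i j) = 1 - l i.
  by rewrite -l1 (bigD1_ord i)//= addrAC subrr add0r.
exists (fun j => l (lift i j) / (1 - l i)); split; last split.
- by move=> j'; rewrite divr_ge0// ltW.
- by rewrite -mulr_suml sum_others divff// gt_eqF.
- apply: (scalerI (lt0r_neq0 d0)); rewrite scaler_sumr scalerBl scale1r {1}vi.
  rewrite (bigD1_ord i)//= addrAC subrr add0r; apply: eq_bigr => j' _.
  by rewrite scalerA mulrC divfK// gt_eqF.
Qed.

Definition irredundant k (v : 'I_k -> 'rV[R]_n) := forall i (l : 'I_k -> R),
  (forall j, 0 <= l j) -> \sum_j l j = 1 -> v i = \sum_j l j *: v j -> l i = 1.

Lemma polytope_irredundant m P : polytope_le m P ->
  exists k (v : 'I_k -> 'rV[R]_n), [/\ (k <= m)%N, P = conv_hull v & irredundant v].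
Proof.
move=> [k0 [v0 [k0m P0]]].
pose spanned k := `[< exists v : 'I_k -> 'rV[R]_n, P = conv_hull v >].
have ex_spanned : exists k, spanned k by exists k0; apply/asboolP; exists v0.
case: (ex_minnP ex_spanned) => k /asboolP[v Pv] kmin; exists k, v; split=> //.
  by apply: leq_trans k0m; apply: kmin; apply/asboolP; exists v0.
case: k v kmin Pv => [|k] v kmin Pv i; first by case: i.
move=> l l0 l1 vi; apply/eqP; rewrite eq_le; apply/andP; split.
  by rewrite -l1 (bigD1 i)//= lerDl sumr_ge0.
rewrite leNgt; apply/negP => li; suff : (k < k)%N by rewrite ltnn.
by apply: kmin; apply/asboolP; exists (v \o lift i); rewrite -(conv_hull_drop l0 l1 vi li).
Qed.

End ConvexHull.

(* If the diagonal of A^2 is 1, row i of A has a positive entry A_ij, and then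
   A_ji = 1, so that row j is a unit vector. *)
Lemma stochastic_square_diag1 (R : realFieldType) k (A : 'I_k -> 'I_k -> R) i :
  (forall a b, 0 <= A a b) -> (forall a, \sum_b A a b = 1) ->
  \sum_j A i j * A j i = 1 -> exists j, forall l, A j l = (l == i)%:R.
Proof.
move=> A0 A1 AAii.
have A_le1 a b : A a b <= 1 by rewrite -(A1 a) (bigD1 b)//= lerDl sumr_ge0.
have [j Aij] : exists j, 0 < A i j.
  apply/existsP; apply: contraT; rewrite negb_exists => /forallP Ai_le0.
  have := A1 i; rewrite big1 => [/esym/eqP|j _]; first by rewrite oner_eq0.
  by apply/eqP; rewrite eq_le A0 andbT leNgt.
have Aji : A j i = 1.
  have : \sum_j A i j * (1 - A j i) = 0.
    by under eq_bigr do rewrite mulrBr mulr1; rewrite sumrB A1 AAii subrr.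
  move=> /eqP; rewrite psumr_eq0 => [|a _]; last by rewrite mulr_ge0// subr_ge0.
  move=> /allP/(_ j (mem_index_enum _)) /=.
  by rewrite mulf_eq0 gt_eqF//= subr_eq0 eq_sym => /eqP.
exists j => l; have [->|li] := eqVneq l i; first exact: Aji.
have := A1 j; rewrite (bigD1 i)//= Aji -[RHS]addr0 => /addrI /eqP.
by rewrite psumr_eq0// => /allP/(_ l (mem_index_enum _)); rewrite li => /eqP.
Qed.

(* Write -v_i as a convex combination with coefficients A_ij; then
   v_i = sum_l (A^2)_il v_l, so irredundancy gives (A^2)_ii = 1. *)
Lemma irredundant_sym (R : realType) n k (v : 'I_k -> 'rV[R]_n) :
  irredundant v -> sym_about 0 (conv_hull v) -> forall i, exists j, v j = - v i.
Proof.
move=> irr_v /sym_about0P sym_v.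
have /choice[A A_spec] : forall i, exists l : 'I_k -> R,
    (forall j, 0 <= l j) /\ \sum_j l j = 1 /\ - v i = \sum_j l j *: v j.
  by move=> i; apply: sym_v; exact: conv_hull_vertex.
have A0 i j : 0 <= A i j by have [+ _] := A_spec i.
have A1 i : \sum_j A i j = 1 by have [_ []] := A_spec i.
have Av i : - v i = \sum_j A i j *: v j by have [_ []] := A_spec i.
pose AA i l := \sum_j A i j * A j l.
have AAii i : AA i i = 1.
  apply: irr_v => [l||]; first by apply: sumr_ge0 => j _; exact: mulr_ge0.
    rewrite exchange_big /= -[RHS](A1 i); apply: eq_bigr => j _.
    by rewrite -mulr_sumr A1 mulr1.
  rewrite -[LHS]opprK Av -sumrN.
  under eq_bigr => j _ do rewrite -scalerN Av scaler_sumr.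
  rewrite exchange_big /=; apply: eq_bigr => l _; rewrite scaler_suml.
  by apply: eq_bigr => j _; rewrite scalerA.
move=> i; have [j Aj] := stochastic_square_diag1 A0 A1 (AAii i).
exists j; apply/eqP; rewrite -eqr_oppLR Av (bigD1 i)//= Aj eqxx scale1r big1 ?addr0//.
by move=> l /negPf li; rewrite Aj li scale0r.
Qed.

Section InscribedPolytopes.
Variables (R : realType) (n m : nat).
Implicit Types (A K P : set 'rV[R]_n) (o w : 'rV[R]_n).

Lemma polytope_scale (c : R) P : polytope_le m P -> polytope_le m ( *:%R c @` P).
Proof.
move=> [k [v [km ->]]]; exists k, (fun i => c *: v i); split=> //.
have scale_comb (l : 'I_k -> R) : c *: (\sum_i l i *: v i) = \sum_i l i *: (c *: v i).
  by rewrite scaler_sumr; apply: eq_bigr => i _; rewrite !scalerA mulrC.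
apply/seteqP; split=> x.
  by move=> [_ [l [l0 [l1 ->]]] <-]; exists l; rewrite scale_comb.
by move=> [l [l0 [l1 ->]]]; exists (\sum_i l i *: v i); rewrite ?scale_comb//; exists l.
Qed.

Lemma polytope_translate w P :
  polytope_le m P -> polytope_le m ((fun x => x + w) @` P).
Proof.
move=> [k [v [km ->]]]; exists k, (fun i => v i + w); split=> //.
have translate_comb (l : 'I_k -> R) :
    \sum_i l i = 1 -> \sum_i l i *: v i + w = \sum_i l i *: (v i + w).
  move=> l1; under [RHS]eq_bigr do rewrite scalerDr.
  by rewrite big_split /= -scaler_suml l1 scale1r.
apply/seteqP; split=> x.
  by move=> [_ [l [l0 [l1 ->]]] <-]; exists l; rewrite translate_comb.
by move=> [l [l0 [l1 ->]]]; exists (\sum_i l i *: v i); rewrite ?translate_comb//; exists l.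
Qed.

Lemma sym_about_scale (c : R) o A : sym_about o A -> sym_about (c *: o) ( *:%R c @` A).
Proof.
move=> sA _ [x Ax <-]; exists (2 *: o - x); first exact: sA.
by rewrite scalerBr !scalerA mulrC.
Qed.

Lemma sym_about_translate o w A :
  sym_about o A -> sym_about (o + w) ((fun x => x + w) @` A).
Proof.
move=> sA _ [x Ax <-]; exists (2 *: o - x); first exact: sA.
by apply/rowP => i; rewrite !mxE; ring.
Qed.

Definition inscribed_polytope K o P := [/\ polytope_le m P, P `<=` K & sym_about o P].

Lemma inscribed_polytope_scale (c : R) K o P : inscribed_polytope K o P ->
  inscribed_polytope ( *:%R c @` K) (c *: o) ( *:%R c @` P).
Proof.
move=> [plP PK sP].
by split; [exact: polytope_scale | exact: image_subset | exact: sym_about_scale].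
Qed.

Lemma inscribed_polytope_translate w K o P : inscribed_polytope K o P ->
  inscribed_polytope ((fun x => x + w) @` K) (o + w) ((fun x => x + w) @` P).
Proof.
move=> [plP PK sP].
by split; [exact: polytope_translate | exact: image_subset | exact: sym_about_translate].
Qed.

Lemma psi_ge K o P : inscribed_polytope K o P ->
  ((fine (vol P) / fine (vol K))%:E <= psi m K o)%E.
Proof. by move=> [plP PK sP]; apply: ereal_sup_ubound; exists P. Qed.

Lemma psi_le K o (b : \bar R) :
  (forall P, inscribed_polytope K o P -> ((fine (vol P) / fine (vol K))%:E <= b)%E) ->
  (psi m K o <= b)%E.
Proof. by move=> ratio_le; apply: ge_ereal_sup => _ [P [? ? ? ->]]; exact: ratio_le. Qed.

Lemma psi_ge0 K o : (0 <= psi m K o)%E.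
Proof.
pose P := conv_hull (fun _ : 'I_0 => 0 : 'rV[R]_n).
have P_empty x : ~ P x by move=> [l [_ [/eqP]]]; rewrite big_ord0 eq_sym oner_eq0.
apply: (@le_trans _ _ (fine (vol P) / fine (vol K))%:E).
  by rewrite lee_fin divr_ge0// fine_ge0// vol_ge0.
by apply: psi_ge; split=> [|x /P_empty//|x /P_empty//]; exists 0, (fun _ => 0).
Qed.

Lemma psi_translate_le w K o :
  (psi m K o <= psi m ((fun x => x + w)%R @` K) (o + w)%R)%E.
Proof.
apply: psi_le => P /(inscribed_polytope_translate w)/psi_ge.
by rewrite !vol_translate.
Qed.

End InscribedPolytopes.

(** * Euclidean geometry *)

Section DotProduct.
Variables (R : realFieldType) (n : nat).
Implicit Types x y u : 'rV[R]_n.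

Definition dot x y : R := \sum_i x 0 i * y 0 i.

Lemma dotC x y : dot x y = dot y x.
Proof. by apply: eq_bigr => i _; rewrite mulrC. Qed.

Lemma dotDl x y u : dot (x + y) u = dot x u + dot y u.
Proof. by rewrite -big_split; apply: eq_bigr => i _; rewrite mxE mulrDl. Qed.

Lemma dotZl c x u : dot (c *: x) u = c * dot x u.
Proof. by rewrite mulr_sumr; apply: eq_bigr => i _; rewrite mxE mulrA. Qed.

Lemma dotNl x u : dot (- x) u = - dot x u.
Proof. by rewrite -scaleN1r dotZl mulN1r. Qed.

Lemma dotDr x y u : dot u (x + y) = dot u x + dot u y.
Proof. by rewrite dotC dotDl !(dotC _ u). Qed.

Lemma dotZr c x u : dot u (c *: x) = c * dot u x.
Proof. by rewrite dotC dotZl dotC. Qed.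

Lemma dotNr x u : dot u (- x) = - dot u x.
Proof. by rewrite dotC dotNl dotC. Qed.

Definition dotE := (dotDl, dotDr, dotZl, dotZr, dotNl, dotNr).

Lemma dot0l u : dot 0 u = 0.
Proof. by rewrite -(scale0r u) dotZl mul0r. Qed.

Lemma dot_suml (I : Type) (r : seq I) (F : I -> 'rV[R]_n) u :
  dot (\sum_(i <- r) F i) u = \sum_(i <- r) dot (F i) u.
Proof. exact: (big_morph (dot^~ u) (fun x y => dotDl x y u) (dot0l u)). Qed.

Lemma dot_ge0 x : 0 <= dot x x.
Proof. by apply: sumr_ge0 => i _; rewrite -expr2 sqr_ge0. Qed.

Lemma dot_eq0 x : (dot x x == 0) = (x == 0).
Proof.
apply/idP/eqP => [|->]; last by rewrite dot0l.
rewrite psumr_eq0 => [/allP x0|i _]; last by rewrite -expr2 sqr_ge0.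
apply/rowP => i; have := x0 i (mem_index_enum _); rewrite -expr2 sqrf_eq0 mxE.
by move=> /eqP.
Qed.

Lemma dot_gt0 x : (0 < dot x x) = (x != 0).
Proof. by rewrite lt0r dot_ge0 andbT dot_eq0. Qed.

End DotProduct.

Section EuclideanNorm.
Variables (R : rcfType) (n : nat).
Implicit Types x y : 'rV[R]_n.

Definition enorm x : R := Num.sqrt (dot x x).

Lemma enorm_ge0 x : 0 <= enorm x. Proof. exact: sqrtr_ge0. Qed.

Lemma enorm_gt0 x : (0 < enorm x) = (x != 0). Proof. by rewrite sqrtr_gt0 dot_gt0. Qed.

Lemma enorm0 : enorm (0 : 'rV[R]_n) = 0. Proof. by rewrite /enorm dot0l sqrtr0. Qed.

Lemma enorm_sqr x : enorm x ^+ 2 = dot x x.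
Proof. by rewrite sqr_sqrtr// dot_ge0. Qed.

Lemma enormN x : enorm (- x) = enorm x.
Proof. by rewrite /enorm dotNl dotNr opprK. Qed.

Lemma enormZ c x : enorm (c *: x) = `|c| * enorm x.
Proof. by rewrite /enorm dotZl dotZr mulrA -expr2 sqrtrM ?sqr_ge0// sqrtr_sqr. Qed.

Lemma enorm_le x (c : R) : 0 <= c -> (enorm x <= c) = (dot x x <= c ^+ 2).
Proof. by move=> c0; rewrite -enorm_sqr ler_sqr// nnegrE enorm_ge0. Qed.

Lemma dot_le_enorm x y : dot x y <= enorm x * enorm y.
Proof.
have [->|x0] := eqVneq x 0; first by rewrite dot0l enorm0 mul0r.
have [->|y0] := eqVneq y 0; first by rewrite dotC dot0l enorm0 mulr0.
have xy0 : 0 < enorm x * enorm y by rewrite mulr_gt0 ?enorm_gt0.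
have := dot_ge0 (enorm y *: x - enorm x *: y).
rewrite !dotE -!enorm_sqr (dotC y x) => sqr_ge0.
rewrite -subr_ge0 -(pmulr_rge0 _ xy0); nra.
Qed.

Lemma enormD x y : enorm (x + y) <= enorm x + enorm y.
Proof.
rewrite enorm_le ?addr_ge0 ?enorm_ge0// !dotE -!enorm_sqr (dotC y x).
have := dot_le_enorm x y; nra.
Qed.

End EuclideanNorm.

Section EuclideanTopology.
Variables (R : realType) (n : nat).
Implicit Types (x y : 'rV[R]_n) (K : set 'rV[R]_n).

Lemma continuous_dot (T : topologicalType) (f g : T -> 'rV[R]_n) :
  continuous f -> continuous g -> continuous (fun t => dot (f t) (g t)).
Proof.
move=> cf cg; apply: (@continuous_sum R T R) => i t.
have coord (h : T -> 'rV[R]_n) : continuous h -> {for t, continuous (fun t => h t 0 i)}.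
  move=> ch; apply: (@continuous_comp _ _ _ h (fun x => x 0 i)); first exact: ch.
  exact: coord_continuous.
by apply: continuousM; exact: coord.
Qed.

Lemma continuous_enorm : continuous (@enorm R n).
Proof.
move=> x; apply: (@continuous_comp _ _ _ (fun x => dot x x) Num.sqrt).
  by apply: continuous_dot => y; exact: cvg_id.
exact: sqrt_continuous.
Qed.

Lemma continuous_enormB x : continuous (fun y => enorm (y - x)).
Proof.
move=> y; apply: (@continuous_comp _ _ _ (fun y : 'rV[R]_n => y - x) (@enorm R n)).
  exact: continuous_translate.
exact: continuous_enorm.
Qed.

Lemma norm_le_enorm x : `|x| <= enorm x.
Proof.
apply: row_norm_le => [|i]; first exact: enorm_ge0.
rewrite -sqrtr_sqr ler_sqrt ?dot_ge0// /dot (bigD1 i)//= expr2 lerDl.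
by apply: sumr_ge0 => j _; rewrite -expr2 sqr_ge0.
Qed.

Definition eball (r : R) : set 'rV[R]_n := [set x | enorm x <= r].

Lemma unit_ballE : @unit_ball R n = eball 1.
Proof.
apply/seteqP; split=> x; rewrite /unit_ball /eball /= enorm_le// expr1n;
  by under eq_bigr do rewrite expr2.
Qed.

Lemma compact_eball r : compact (eball r).
Proof.
apply: bounded_closed_compact.
  exists r; split; first exact: num_real.
  by move=> M /ltW rM x xr; apply: le_trans rM; apply: le_trans xr; exact: norm_le_enorm.
by apply: (closed_comp _ (@closed_le R r)) => x _; exact: continuous_enorm.
Qed.

Lemma compact_sub_eball K : compact K -> exists2 r : R, 0 < r & K `<=` eball r.
Proof.
move=> /(compact_image continuous_enorm)/compact_bounded[M [_ KM]].
exists (Num.max M 0 + 1) => [|x Kx]; first by rewrite ltr_wpDl// le_max lexx orbT.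
have := KM (Num.max M 0 + 1); rewrite ltr_pwDr// ?le_max ?lexx// => /(_ erefl (enorm x)).
by rewrite /= ger0_norm ?enorm_ge0//; apply; exists x.
Qed.

Lemma eball_scale r : 0 < r -> eball r = *:%R r @` eball 1.
Proof.
move=> r0; apply/seteqP; split=> [x xr|_ [y y1 <-]].
  exists (r^-1 *: x); last by rewrite scalerA divff ?gt_eqF// scale1r.
  by rewrite /eball /= enormZ gtr0_norm ?invr_gt0// mulrC ler_pdivrMr// mul1r.
by rewrite /eball /= enormZ gtr0_norm// -[leRHS]mulr1 ler_pM2l.
Qed.

Lemma vol_eball r : 0 < r -> vol (eball r) = ((r ^+ n)%:E * vol (eball 1))%E.
Proof. by move=> r0; rewrite eball_scale// vol_scale. Qed.

Lemma vol_eball1_gt0 : (0 < vol (eball 1))%E.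
Proof.
apply: vol_gt0; exists 0.
have open_unit : open (@enorm R n @^-1` [set r | r < 1]).
  by apply: (open_comp _ (@open_lt R 1)) => x _; exact: continuous_enorm.
have unit0 : (@enorm R n @^-1` [set r | r < 1]) 0 by rewrite /= enorm0.
by apply: filterS (open_nbhs_nbhs (conj open_unit unit0)) => x /ltW.
Qed.

Lemma exists_nearest_point K q : compact K -> K !=set0 ->
  exists2 p, K p & forall x, K x -> enorm (p - q) <= enorm (x - q).
Proof.
move=> coK K0.
have [|p pK pmin] := @EVT_min_rV R n (fun x => enorm (x - q)) _ K0 coK.
  by apply: continuous_subspaceT; exact: continuous_enormB.
by exists p => [|x Kx]; [exact: set_mem | apply: pmin; exact: mem_set].
Qed.

(* The derivative of |p + t(x - p) - q|^2 at t = 0 is nonnegative. *)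
Lemma nearest_point_obtuse K p q : convex_set K -> K p ->
  (forall x, K x -> enorm (p - q) <= enorm (x - q)) ->
  forall x, K x -> dot (x - p) (q - p) <= 0.
Proof.
move=> cK Kp pmin x Kx; rewrite leNgt; apply/negP.
set a := dot _ _ => a0; pose D := dot (x - p) (x - p).
have D0 : 0 <= D by exact: dot_ge0.
have aD : 0 < a + D by lra.
pose t := a / (a + D).
have t0 : 0 < t by rewrite divr_gt0.
have t1 : t <= 1 by rewrite ler_pdivrMr// mul1r lerDl.
have tD : t * (a + D) = a by rewrite divfK// gt_eqF.
have := pmin _ (cK _ _ _ Kx Kp (ltW t0) t1).
have -> : t *: x + (1 - t) *: p - q = t *: (x - p) - (q - p).
  by apply/rowP => i; rewrite !mxE; ring.
rewrite -[p - q]opprB enormN enorm_le ?enorm_ge0// enorm_sqr.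
have -> : dot (t *: (x - p) - (q - p)) (t *: (x - p) - (q - p)) =
    t ^+ 2 * D - 2 * (t * a) + dot (q - p) (q - p).
  by rewrite /a /D; move: (x - p) (q - p) => y v; rewrite !dotE (dotC v y); ring.
have : t * (t * D) <= t * a by rewrite ler_pM2l//; nra.
nra.
Qed.

Lemma exists_separating_unit K q : convex_set K -> compact K -> K !=set0 -> ~ K q ->
  exists2 w, enorm w = 1 & forall x, K x -> dot x w <= dot q w.
Proof.
move=> cK coK K0 nKq; have [p Kp pmin] := exists_nearest_point q coK K0.
have obtuse := nearest_point_obtuse cK Kp pmin.
set v := q - p in obtuse.
have v0 : v != 0 by rewrite subr_eq0; apply/eqP => qp; apply: nKq; rewrite qp.
exists ((enorm v)^-1 *: v).
  by rewrite enormZ ger0_norm ?invr_ge0 ?enorm_ge0// mulVf// gt_eqF// enorm_gt0.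
move=> x Kx; rewrite !dotZr ler_wpM2l ?invr_ge0 ?enorm_ge0//.
have vv : dot v v = dot q v - dot p v by rewrite -dotNl -dotDl.
have := obtuse _ Kx; have := dot_ge0 v; rewrite vv dotDl dotNl; lra.
Qed.

Lemma finite_net_unit_sphere (e : R) : 0 < e -> exists zs : seq 'rV[R]_n,
  {in zs, forall z, enorm z = 1} /\
  forall x, enorm x = 1 -> exists2 z, z \in zs & enorm (x - z) < e.
Proof.
move=> e0; pose S := @enorm R n @^-1` [set 1].
have : compact S.
  apply: (subclosed_compact _ (@compact_eball 1)) => [|x]; last by rewrite /eball /= => ->.
  by apply: (closed_comp _ (@closed_eq R 1)) => x _; exact: continuous_enorm.
rewrite compact_cover => /(_ _ S (fun z => [set x | enorm (x - z) < e])).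
case=> [z _|x Sx|D DS cov].
- by apply: (open_comp _ (@open_lt R e)) => x _; exact: continuous_enormB.
- by exists x => //=; rewrite subrr enorm0.
exists (finmap.enum_fset D); split=> [z zD|x Sx]; first by have := DS z zD; rewrite inE.
by have [z zD xz] := cov _ Sx; exists z.
Qed.

End EuclideanTopology.

(** * Steiner symmetrization *)

Section Reflection.
Variables (R : realFieldType) (n : nat).
Implicit Types x y u : 'rV[R]_n.

(* Division by 0 gives 0, so that proj_coef 0 x = 0 and mirror 0 x = x. *)
Definition proj_coef u x : R := dot x u / dot u u.

Lemma proj_coefD u x y : proj_coef u (x + y) = proj_coef u x + proj_coef u y.
Proof. by rewrite /proj_coef dotDl mulrDl. Qed.

Lemma proj_coefZ u c x : proj_coef u (c *: x) = c * proj_coef u x.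
Proof. by rewrite /proj_coef dotZl mulrA. Qed.

Lemma proj_coefN u x : proj_coef u (- x) = - proj_coef u x.
Proof. by rewrite /proj_coef dotNl mulNr. Qed.

Lemma proj_coef_self u : u != 0 -> proj_coef u u = 1.
Proof. by move=> u0; rewrite /proj_coef divff// dot_eq0. Qed.

Lemma proj_coef_line u x t : u != 0 -> proj_coef u (x + t *: u) = proj_coef u x + t.
Proof. by move=> u0; rewrite proj_coefD proj_coefZ proj_coef_self// mulr1. Qed.

Lemma proj_coef_sum u (I : finType) (l : I -> R) (F : I -> 'rV[R]_n) :
  proj_coef u (\sum_i l i *: F i) = \sum_i l i * proj_coef u (F i).
Proof.
rewrite /proj_coef dot_suml mulr_suml; apply: eq_bigr => i _.
by rewrite dotZl mulrA.
Qed.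

Lemma proj_coefZl u c x : proj_coef (c *: u) x = c^-1 * proj_coef u x.
Proof.
have [->|c0] := eqVneq c 0; first by rewrite invr0 scale0r /proj_coef dotC !dot0l !mul0r.
rewrite /proj_coef !(dotZl, dotZr) !invfM; move: (dot x u) (dot u u)^-1 => a b.
by field.
Qed.

Lemma dot_line u x t : dot (x + t *: u) (x + t *: u) =
  dot x x + (t ^+ 2 + 2 * t * proj_coef u x) * dot u u.
Proof.
have xu : dot x u = proj_coef u x * dot u u.
  have [->|u0] := eqVneq u 0; first by rewrite dotC !dot0l mulr0.
  by rewrite /proj_coef divfK// dot_eq0.
rewrite !dotE (dotC u x) xu; ring.
Qed.

Definition mirror u x := x - (2 * proj_coef u x) *: u.

Lemma mirrorD u x y : mirror u (x + y) = mirror u x + mirror u y.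
Proof. by rewrite /mirror proj_coefD mulrDr scalerDl opprD addrACA. Qed.

Lemma mirrorN u x : mirror u (- x) = - mirror u x.
Proof. by rewrite /mirror proj_coefN mulrN scaleNr opprD. Qed.

Lemma mirror_sum u (I : finType) (l : I -> R) (F : I -> 'rV[R]_n) :
  mirror u (\sum_i l i *: F i) = \sum_i l i *: mirror u (F i).
Proof.
rewrite /mirror proj_coef_sum mulr_sumr scaler_suml -sumrB; apply: eq_bigr => i _.
by rewrite scalerBr scalerA mulrCA.
Qed.

Lemma mirror_line u x t : u != 0 -> mirror u (x + t *: u) = mirror u x - t *: u.
Proof.
by move=> u0; rewrite /mirror proj_coef_line//; apply/rowP => i; rewrite !mxE; ring.
Qed.

Lemma dot_mirror u x : dot (mirror u x) (mirror u x) = dot x x.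
Proof. by rewrite /mirror -scaleNr dot_line; ring. Qed.

Lemma mirror_swap x y : dot x x = dot y y -> x != y -> mirror (x - y) y = x.
Proof.
move=> xx xy; have xy0 : dot (x - y) (x - y) != 0 by rewrite dot_eq0 subr_eq0.
have sqr_dist : dot (x - y) (x - y) = - (2 * dot y (x - y)).
  by rewrite !dotE (dotC x y) xx; ring.
have -> : mirror (x - y) y = y + (x - y); last by rewrite addrC subrK.
rewrite /mirror /proj_coef mulrA -[2 * _]opprK -sqr_dist mulNr divff//.
by rewrite scaleN1r opprK.
Qed.

End Reflection.

Section Steiner.
Variables (R : realType) (n : nat).
Implicit Types (x y u : 'rV[R]_n) (K : set 'rV[R]_n).

Lemma enorm_mirror u x : enorm (mirror u x) = enorm x.
Proof. by rewrite /enorm dot_mirror. Qed.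

Lemma continuous_proj_coef (T : topologicalType) u (f : T -> 'rV[R]_n) :
  continuous f -> continuous (fun t => proj_coef u (f t)).
Proof.
move=> cf t; apply: (@continuousM R T (fun t => dot (f t) u) (cst (dot u u)^-1)).
  by apply: continuous_dot => // ?; exact: cst_continuous.
exact: cst_continuous.
Qed.

(* The chord of K on the line x + Ru is recentred at the hyperplane orthogonal to u. *)
Definition steiner u K : set 'rV[R]_n :=
  [set x | exists a b : R, [/\ K (x + a *: u), K (x + b *: u) &
    2 * `|proj_coef u x| <= b - a]].

Lemma steiner_convex u K : convex_set K -> convex_set (steiner u K).
Proof.
move=> cK x y t [a [b [xa xb ab]]] [a' [b' [ya yb ab']]] t0 t1.
have comb_line c c' : t *: x + (1 - t) *: y + (t * c + (1 - t) * c') *: u =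
    t *: (x + c *: u) + (1 - t) *: (y + c' *: u).
  by apply/rowP => i; rewrite !mxE; ring.
exists (t * a + (1 - t) * a'), (t * b + (1 - t) * b'); split.
- by rewrite comb_line; exact: cK.
- by rewrite comb_line; exact: cK.
- rewrite proj_coefD !proj_coefZ (le_trans (ler_wpM2l _ (ler_normD _ _)))//.
  have t1' : 0 <= 1 - t by rewrite subr_ge0.
  rewrite (normrM t) (normrM (1 - t)) (ger0_norm t0) (ger0_norm t1').
  have := ler_wpM2l t0 ab; have := ler_wpM2l t1' ab'; lra.
Qed.

Lemma steiner_sym u K : sym_about 0 K -> sym_about 0 (steiner u K).
Proof.
move=> /sym_about0P sK; apply/sym_about0P => x [a [b [xa xb ab]]].
exists (- b), (- a); split; last by rewrite proj_coefN normrN opprK addrC.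
- by rewrite scaleNr -opprD; exact: sK.
- by rewrite scaleNr -opprD; exact: sK.
Qed.

Lemma steinerZ u c K : c != 0 -> steiner (c *: u) K = steiner u K.
Proof.
have sub_scaled v d : d != 0 -> steiner v K `<=` steiner (d *: v) K.
  move=> d0 x [a [b [xa xb ab]]].
  have rescale e : (e / d) *: (d *: v) = e *: v by rewrite scalerA divfK.
  have ab' : 2 * `|proj_coef (d *: v) x| <= (b - a) / `|d|.
    by rewrite proj_coefZl normrM normfV mulrCA ler_pdivlMr ?normr_gt0// mulrC mulVKf ?normr_eq0.
  have [d_gt0|d_lt0] := leP 0 d.
    exists (a / d), (b / d); rewrite !rescale; split=> //.
    by rewrite -mulrBl -[X in _ / X](ger0_norm d_gt0).
  exists (b / d), (a / d); rewrite !rescale; split=> //.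
  by rewrite -mulrBl -opprB mulNr -mulrN -invrN -[X in _ / X](ltr0_norm d_lt0).
move=> c0; apply/seteqP; split; last exact: sub_scaled.
rewrite -{2}[u](scalerK c0); apply: sub_scaled; exact: invr_neq0.
Qed.

Lemma steiner_mirror u K x : u != 0 -> steiner u K x -> steiner u K (mirror u x).
Proof.
move=> u0 [a [b [xa xb ab]]].
have back c : mirror u x + (c + 2 * proj_coef u x) *: u = x + c *: u.
  by rewrite /mirror -scaleNr -addrA -scalerDl addrCA addNr addr0.
exists (a + 2 * proj_coef u x), (b + 2 * proj_coef u x); rewrite !back; split=> //.
rewrite /mirror -scaleNr proj_coef_line//.
rewrite (_ : proj_coef u x - 2 * _ = - proj_coef u x); last by ring.
by rewrite normrN opprD addrACA subrr addr0.
Qed.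

(* If x is on the positive side of the hyperplane, the upper end p = x + b u of
   the chord works: for b >= 0 because |p|^2 >= |x|^2 + |x - p|^2, and otherwise
   because the lower end is even further from x. *)
Lemma steiner_near u K rho x : u != 0 -> K `<=` eball rho -> steiner u K x ->
  exists2 p, K p & dot (x - p) (x - p) <= rho ^+ 2 - dot x x.
Proof.
move=> u0 Kr [a [b [xa xb]]]; set t := proj_coef u x => ab.
have rho0 : 0 <= rho by apply: le_trans (enorm_ge0 _) (Kr _ xa).
have dist c : dot (x - (x + c *: u)) (x - (x + c *: u)) = c ^+ 2 * dot u u.
  by rewrite opprD addrA subrr sub0r dotNl dotNr opprK !dotE; ring.
have bound c d : K (x + d *: u) -> c ^+ 2 <= d ^+ 2 + 2 * d * t ->
    c ^+ 2 * dot u u <= rho ^+ 2 - dot x x.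
  move=> /Kr; rewrite /eball /= enorm_le// dot_line -/t => xd cd.
  by rewrite lerBrDl (le_trans _ xd)// lerD2l ler_wpM2r// dot_ge0.
have [t0|t0] := leP 0 t; [rewrite ger0_norm// in ab|rewrite ltr0_norm// in ab].
  exists (x + b *: u); rewrite // dist.
  by have [b0|b0] := leP 0 b; [apply: (bound b b) | apply: (bound b a)] => //; nra.
exists (x + a *: u); rewrite // dist.
by have [a0|a0] := leP a 0; [apply: (bound a a) | apply: (bound a b)] => //; nra.
Qed.

Lemma steiner_sub_eball u K rho : u != 0 -> K `<=` eball rho -> steiner u K `<=` eball rho.
Proof.
move=> u0 Kr x /(steiner_near u0 Kr)[p Kp xp].
have rho0 : 0 <= rho by apply: le_trans (enorm_ge0 _) (Kr _ Kp).
by rewrite /eball /= enorm_le// -subr_ge0; apply: le_trans xp; exact: dot_ge0.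
Qed.

(* A point of the symmetral is given by the ends p = z.1, q = z.2.1 of a chord of K
   parallel to u and by its relative position s = z.2.2 on the recentred chord. *)
Definition parallel_chords u K : set ('rV[R]_n * ('rV[R]_n * R)) :=
  (K `*` (K `*` `[-1, 1])) `&`
  ([set z | z.2.1 - z.1 - proj_coef u (z.2.1 - z.1) *: u = 0] `&`
   [set z | 0 <= proj_coef u (z.2.1 - z.1)]).

Definition recentred_point u (z : 'rV[R]_n * ('rV[R]_n * R)) : 'rV[R]_n :=
  z.1 + (z.2.2 * (proj_coef u (z.2.1 - z.1) / 2) - proj_coef u z.1) *: u.

Lemma steinerE u K : u != 0 -> steiner u K = recentred_point u @` parallel_chords u K.
Proof.
move=> u0; apply/seteqP; split=> x.
  move=> [a [b [xa xb ab]]]; set t := proj_coef u x in ab *.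
  have L : proj_coef u (x + b *: u - (x + a *: u)) = b - a.
    by rewrite proj_coefD proj_coefN !proj_coef_line//; ring.
  have ab0 : 0 <= b - a by apply: le_trans ab; rewrite mulr_ge0.
  have pos : 2 * t / (b - a) * ((b - a) / 2) = t.
    have [e|ne] := eqVneq (b - a) 0; last by field.
    rewrite e mul0r mulr0; apply/esym/eqP; rewrite -normr_le0.
    by move: ab; rewrite e pmulr_rle0.
  exists (x + a *: u, (x + b *: u, 2 * t / (b - a))); rewrite /recentred_point /= ?L; last first.
    by rewrite pos proj_coef_line// -/t opprD addrA subrr sub0r scaleNr addrK.
  split; last by split; rewrite /= L//; apply/rowP => i; rewrite !mxE; ring.
  split=> //; split=> //=; rewrite in_itv /= -ler_norml normrM normfV.
  rewrite (ger0_norm ab0) normrM (@ger0_norm _ 2)//.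
  move: ab0; rewrite le_eqVlt => /predU1P[<-|ab_gt0]; first by rewrite invr0 mulr0 ler01.
  by rewrite ler_pdivrMr// mul1r.
move=> [[p [q s]] [[/= Kp [Kq s1]] [/= qp L0]] <-].
move: qp L0; rewrite /recentred_point /=.
set L := proj_coef u (q - p); set t := proj_coef u p => qp L0.
exists (t - s * (L / 2)), (t - s * (L / 2) + L).
have unwind c : p + (s * (L / 2) - t) *: u + (t - s * (L / 2) + c) *: u = p + c *: u.
  by rewrite -addrA -scalerDl; congr (_ + _ *: _); ring.
split.
- by have := unwind 0; rewrite addr0 scale0r addr0 => ->.
- by rewrite unwind; move/eqP: qp; rewrite subr_eq0 => /eqP <-; rewrite addrC subrK.
- have L2 : 0 <= L / 2 by lra.
  rewrite proj_coef_line// -/t [t + _]addrC subrK normrM (ger0_norm L2).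
  have s_le1 : `|s| <= 1 by move: s1; rewrite in_itv /= -ler_norml.
  have := ler_wpM2r L0 s_le1; lra.
Qed.

Lemma steiner_compact u K : u != 0 -> compact K -> compact (steiner u K).
Proof.
move=> u0 coK; pose E : Type := 'rV[R]_n * ('rV[R]_n * R).
have cont_p : continuous (fun z : E => z.1) by move=> z; exact: cvg_fst.
have cont_qs : continuous (fun z : E => z.2) by move=> z; exact: cvg_snd.
have cont_q : continuous (fun z : E => z.2.1).
  by move=> z; apply: continuous_comp; [exact: cont_qs | exact: cvg_fst].
have cont_s : continuous (fun z : E => z.2.2).
  by move=> z; apply: continuous_comp; [exact: cont_qs | exact: cvg_snd].
have cont_chord : continuous (fun z : E => z.2.1 - z.1).
  by move=> z; exact: (continuousB (cont_q z) (cont_p z)).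
have cont_length : continuous (fun z : E => proj_coef u (z.2.1 - z.1)).
  exact: continuous_proj_coef.
have cont_foot : continuous (fun z : E => proj_coef u z.1) by exact: continuous_proj_coef.
rewrite steinerE//; apply: compact_image.
  apply: continuous_addZ => // z.
  have cont_half_length := continuousM (cont_length z) (@cst_continuous E R 2^-1 z).
  exact: (continuousB (continuousM (cont_s z) cont_half_length) (cont_foot z)).
apply: compact_closedI.
  by apply: compact_setX => //; apply: compact_setX => //; exact: segment_compact.
apply: closedI; last by apply: (closed_comp _ (@closed_ge R 0)) => z _; exact: cont_length.
have closed0 : closed [set 0 : 'rV[R]_n].
  by apply: accessible_closed_set1; apply: hausdorff_accessible; exact: norm_hausdorff.
apply: (closed_comp _ closed0) => z _.
exact: (continuousB (cont_chord z) (continuousZ (cont_length z) (@cst_continuous E _ u z))).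
Qed.

End Steiner.

Lemma exists_unit_coord_scaling (F : fieldType) n (u : 'rV[F]_n) : u != 0 ->
  exists c j, c != 0 /\ (c *: u) 0 j = 1.
Proof.
move=> u0; have [j uj] : exists j, u 0 j != 0.
  apply/existsP; apply: contraNT u0; rewrite negb_exists => /forallP u_eq0.
  by apply/eqP/rowP => j; rewrite [RHS]mxE; apply/eqP; have := u_eq0 j; rewrite negbK.
by exists (u 0 j)^-1, j; rewrite invr_eq0 mxE mulVf.
Qed.

Lemma unit_coord_neq0 (F : fieldType) n (u : 'rV[F]_n) j : u 0 j = 1 -> u != 0.
Proof. by move=> uj; apply: contra_eq_neq uj => ->; rewrite mxE eq_sym oner_neq0. Qed.

Section SteinerChords.
Variables (R : realType) (n : nat).
Notation V := 'rV[R]_n.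
Notation lambda := (@lebesgue_measure R).
Implicit Types (u x : V) (K : set V).

Lemma steiner_recentred u K x s t e : u != 0 -> K (x + s *: u) -> K (x + t *: u) ->
  2 * `|e| <= t - s -> steiner u K (x + (e - proj_coef u x) *: u).
Proof.
move=> u0 Ks Kt e_le; set d := e - _.
have back c : x + d *: u + (c - d) *: u = x + c *: u.
  by rewrite -addrA -scalerDl [d + _]addrC subrK.
exists (s - d), (t - d); rewrite !back; split=> //.
have -> : proj_coef u (x + d *: u) = e by rewrite proj_coef_line// addrC subrK.
by rewrite (_ : t - d - (s - d) = t - s)//; ring.
Qed.

Lemma measure_chord_le_steiner u K x : u != 0 -> convex_set K -> compact K ->
  (lambda (chord K u x) <= lambda (chord (steiner u K) u x))%E.
Proof.
move=> u0 cK coK; apply: lebesgue_measure_le_diam => // [|s t Ks Kt st].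
  exact: measurable_chord.
have half e : `|e| = (t - s) / 2 ->
    chord (steiner u K) u x (e - proj_coef u x).
  by move=> eE; apply: (steiner_recentred u0 Ks Kt); rewrite eE; lra.
have abs_half : `|(t - s) / 2| = (t - s) / 2 by rewrite ger0_norm//; lra.
have interval : is_interval (chord (steiner u K) u x).
  by apply: is_interval_chord; exact: steiner_convex.
have lower := half (- ((t - s) / 2)); rewrite normrN in lower.
apply: le_trans (lebesgue_measure_interval_ge interval (lower abs_half) (half _ abs_half)).
by rewrite lee_fin (le_trans _ (ler_norm _))//; lra.
Qed.

Section ShiftReflect.
Variables (k : nat) (v : 'I_k -> V) (c : 'I_k -> R) (u : V).

Definition shifted i := v i + c i *: u.

Definition shifted_mirror i := mirror u (v i) + c i *: u.

Lemma chord_shifted x s (l : 'I_k -> R) : u != 0 ->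
  (forall i, 0 <= l i) -> \sum_i l i = 1 -> x + s *: u = \sum_i l i *: v i ->
  chord (conv_hull shifted) u x (s + \sum_i l i * c i) /\
  chord (conv_hull shifted_mirror) u x (\sum_i l i * c i - s - 2 * proj_coef u x).
Proof.
move=> u0 l0 l1 xs; have shift_comb (w : 'I_k -> V) :
    \sum_i l i *: (w i + c i *: u) = \sum_i l i *: w i + (\sum_i l i * c i) *: u.
  rewrite scaler_suml -big_split; apply: eq_bigr => i _.
  by rewrite scalerDr scalerA.
split; exists l; split=> //; split=> //; rewrite shift_comb.
  by rewrite -xs scalerDl addrA.
rewrite -mirror_sum -xs mirror_line// /mirror.
by apply/rowP => i; rewrite !mxE; ring.
Qed.

Lemma measure_chord_shift_mirror x : u != 0 ->
  (2%:E * lambda (chord (conv_hull v) u x) <=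
   lambda (chord (conv_hull shifted) u x) + lambda (chord (conv_hull shifted_mirror) u x))%E.
Proof.
move=> u0; rewrite -lee_pdivlMl//; apply: lebesgue_measure_le_diam.
- by apply: measurable_chord; exact: compact_conv_hull.
- by rewrite mule_ge0// ?lee_fin// adde_ge0.
move=> s t [l [l0 [l1 xs]]] [l' [l'0 [l'1 xt]]] st; rewrite lee_pdivlMl//.
have [ws w's] := chord_shifted u0 l0 l1 xs; have [wt w't] := chord_shifted u0 l'0 l'1 xt.
have interval (w : 'I_k -> V) : is_interval (chord (conv_hull w) u x).
  by apply: is_interval_chord; exact: conv_hull_convex.
apply: le_trans (leeD (lebesgue_measure_interval_ge (interval _) ws wt)
                      (lebesgue_measure_interval_ge (interval _) w't w's)).
rewrite -EFinM -EFinD lee_fin.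
by apply: le_trans (lerD (ler_norm _) (ler_norm _)); lra.
Qed.

End ShiftReflect.

Lemma exists_displacement u K x : convex_set K -> steiner u K x ->
  exists c, K (x + c *: u) /\ K (mirror u x + c *: u).
Proof.
move=> cK [a [b [xa xb]]]; set t := proj_coef u x => ab.
have between c : a <= c <= b -> K (x + c *: u) by exact: is_interval_chord cK _ _ xa xb c.
have mirrorE c : mirror u x + c *: u = x + (c - 2 * t) *: u.
  by rewrite /mirror -/t scalerBl addrAC addrA.
have [t0|t0] := leP 0 t; [rewrite ger0_norm// in ab|rewrite ltr0_norm// in ab].
  by exists b; rewrite mirrorE; split=> //; apply: between; lra.
by exists a; rewrite mirrorE; split=> //; apply: between; lra.
Qed.

Lemma exists_odd_displacement u K : convex_set K -> sym_about 0 K ->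
  exists c : V -> R, (forall x, c (- x) = - c x) /\
    forall x, steiner u K x -> K (x + c x *: u) /\ K (mirror u x + c x *: u).
Proof.
move=> cK sK; have /sym_about0P sK' := sK; have /sym_about0P sS := @steiner_sym _ _ u _ sK.
have /choice[c0 Kc0] : forall x, exists c, steiner u K x ->
    K (x + c *: u) /\ K (mirror u x + c *: u).
  move=> x; have [Sx|nSx] := pselect (steiner u K x); last by exists 0.
  by have [c Kc] := exists_displacement cK Sx; exists c.
have odd_mean x c c' : K (x + c *: u) -> K (- x + c' *: u) -> K (x + ((c - c') / 2) *: u).
  move=> Kx /sK' KNx; have := convex_midpoint cK Kx KNx.
  by congr K; apply/rowP => i; rewrite !mxE; field.
exists (fun x => (c0 x - c0 (- x)) / 2); split=> [x|x Sx].
  by rewrite opprK -mulNr opprB.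
have [Kx K'x] := Kc0 _ Sx; have [KNx] := Kc0 _ (sS _ Sx); rewrite mirrorN => K'Nx.
by split; exact: odd_mean.
Qed.

End SteinerChords.

Section SteinerVolume.
Variables (R : realType) (n : nat).
Notation V := 'rV[R]_n.+1.
Implicit Types (u : V) (K P : set V).

Lemma vol_le_steiner u K : u != 0 -> convex_set K -> compact K ->
  (vol K <= vol (steiner u K))%E.
Proof.
move=> u0 cK coK; have [c [j [c0 uj]]] := exists_unit_coord_scaling u0.
rewrite -(steinerZ u K c0); have cu0 := unit_coord_neq0 uj.
have coS := steiner_compact cu0 coK.
have : (2%:E * vol K <= vol (steiner (c *: u) K) + vol (steiner (c *: u) K))%E.
  apply: (cavalieri uj) => // x.
  by rewrite mule_natl mule2n leeD// measure_chord_le_steiner.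
have fK := vol_compact_fin_num coK; have fS := vol_compact_fin_num coS.
by rewrite -(fineK fK) -(fineK fS) -EFinM -EFinD !lee_fin; lra.
Qed.

Lemma vol_shift_mirror k (v : 'I_k -> V) (c : 'I_k -> R) u j : u 0 j = 1 ->
  (2%:E * vol (conv_hull v) <=
   vol (conv_hull (shifted v c u)) + vol (conv_hull (shifted_mirror v c u)))%E.
Proof.
move=> uj; apply: (cavalieri uj) => [|||x]; try exact: compact_conv_hull.
exact: measure_chord_shift_mirror (unit_coord_neq0 uj).
Qed.

(* The vertices of P are moved along u into K in two ways, the second one being a
   mirror image, and one of the two new polytopes has at least the volume of P. *)
Lemma inscribed_polytope_of_steiner m u K P : u != 0 -> convex_set K -> sym_about 0 K ->
  inscribed_polytope m (steiner u K) 0 P ->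
  exists2 Q, inscribed_polytope m K 0 Q & (vol P <= vol Q)%E.
Proof.
move=> u0 cK sK; have [a [j [a0 uj]]] := exists_unit_coord_scaling u0.
rewrite -(steinerZ u K a0) => -[/polytope_irredundant[k [v [km -> irr_v]]] PS sP].
have v_sym := irredundant_sym irr_v sP.
have [c [cN Kc]] := exists_odd_displacement (a *: u) cK sK.
have Kv i := Kc _ (PS _ (conv_hull_vertex v i)).
pose w := shifted v (c \o v) (a *: u); pose w' := shifted_mirror v (c \o v) (a *: u).
have wN (i l : 'I_k) : v l = - v i -> w l = - w i /\ w' l = - w' i.
  by move=> vl; rewrite /w /w' /shifted /shifted_mirror /= vl cN mirrorN scaleNr !opprD.
have inscribed (q : 'I_k -> V) : (forall i, K (q i)) ->
    (forall i l, v l = - v i -> q l = - q i) -> inscribed_polytope m K 0 (conv_hull q).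
  move=> Kq qN; split; [by exists k, q | exact: conv_hull_sub|].
  by apply: conv_hull_sym => i; have [l vl] := v_sym i; exists l; exact: qN.
have Kw : inscribed_polytope m K 0 (conv_hull w).
  by apply: inscribed => [i|i l /wN[]//]; have [] := Kv i.
have Kw' : inscribed_polytope m K 0 (conv_hull w').
  by apply: inscribed => [i|i l /wN[]//]; have [] := Kv i.
have vol_mean : (2%:E * vol (conv_hull v) <= vol (conv_hull w) + vol (conv_hull w'))%E.
  exact: vol_shift_mirror uj.
have [w'w|/ltW ww'] := leP (vol (conv_hull w')) (vol (conv_hull w)).
  exists (conv_hull w) => //; rewrite -(@lee_pmul2l _ 2%:E)//.
  by rewrite (le_trans vol_mean)// mule_natl mule2n leeD2l.
exists (conv_hull w') => //; rewrite -(@lee_pmul2l _ 2%:E)//.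
by rewrite (le_trans vol_mean)// mule_natl mule2n leeD2r.
Qed.

End SteinerVolume.

(** * Rounding *)

Lemma scale_imageKV (R : fieldType) (V : lmodType R) (c : R) (A : set V) : c != 0 ->
  *:%R c @` ( *:%R c^-1 @` A) = A.
Proof.
move=> c0; rewrite image_comp (_ : _ \o _ = id) ?image_id//.
by apply/funext => x /=; rewrite scalerKV.
Qed.

Section SymBody.
Variables (R : realType) (n m : nat).
Implicit Types (K P Q : set 'rV[R]_n) (u : 'rV[R]_n).

Definition sym_body K := [/\ convex_set K, compact K & sym_about 0 K].

Lemma steiner_sym_body u K : u != 0 -> sym_body K -> sym_body (steiner u K).
Proof.
move=> u0 [cK coK sK].
by split; [exact: steiner_convex | exact: steiner_compact | exact: steiner_sym].
Qed.

Lemma sym_body_scale (c : R) K : sym_body K -> sym_body ( *:%R c @` K).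
Proof.
move=> [cK coK sK]; split; last by rewrite -(scaler0 _ c); exact: sym_about_scale.
- move=> _ _ t [x Kx <-] [y Ky <-] t0 t1; exists (t *: x + (1 - t) *: y); first exact: cK.
  by rewrite scalerDr !scalerA ![c * _]mulrC.
- by apply: compact_image => //; exact: scaler_continuous.
Qed.

Definition psi_dominates K K' := (vol K <= vol K')%E /\
  forall P, inscribed_polytope m K' 0 P ->
    exists2 Q, inscribed_polytope m K 0 Q & (vol P <= vol Q)%E.

Lemma psi_dominates_refl K : psi_dominates K K.
Proof. by split=> // P KP; exists P. Qed.

Lemma psi_dominates_trans K1 K2 K3 :
  psi_dominates K1 K2 -> psi_dominates K2 K3 -> psi_dominates K1 K3.
Proof.
move=> [vol12 dom12] [vol23 dom23]; split; first exact: le_trans vol23.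
move=> P /dom23[Q /dom12[Q' K1Q' QQ'] PQ].
by exists Q' => //; exact: le_trans QQ'.
Qed.

Lemma psi_dominates_scale (c : R) K K' : 0 < c -> psi_dominates K K' ->
  psi_dominates ( *:%R c @` K) ( *:%R c @` K').
Proof.
move=> c0 [KK' dom]; have c_neq0 : c != 0 by rewrite gt_eqF.
split; first by rewrite !vol_scale// lee_pmul2l// lte_fin exprn_gt0.
move=> P /(inscribed_polytope_scale c^-1).
rewrite -{1}[c]invrK scale_imageKV ?invr_eq0// scaler0 => /dom[Q KQ PQ].
exists ( *:%R c @` Q); first by rewrite -(scaler0 _ c); exact: inscribed_polytope_scale.
rewrite -[P](scale_imageKV _ c_neq0) (vol_scale (_ @` P))// vol_scale//.
by rewrite lee_pmul2l// lte_fin exprn_gt0.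
Qed.

End SymBody.

Lemma psi_dominates_steiner (R : realType) n m (u : 'rV[R]_n.+1) K :
  u != 0 -> sym_body K -> psi_dominates m K (steiner u K).
Proof.
move=> u0 [cK coK sK]; split; first exact: vol_le_steiner.
by move=> P; exact: inscribed_polytope_of_steiner.
Qed.

Section Caps.
Variables (R : realType) (n : nat).
Notation V := 'rV[R]_n.
Implicit Types (K : set V) (x z w u : V) (eta d : R).

(* Used for K inside the unit ball: the points of K within d^2 of the unit sphere
   (in squared norm) keep distance eta from z. *)
Definition misses_cap K z eta d :=
  forall x, K x -> 1 - d ^+ 2 <= dot x x -> eta <= enorm (x - z).

Lemma misses_cap_mono K z eta d eta' d' : eta' <= eta -> 0 <= d' <= d ->
  misses_cap K z eta d -> misses_cap K z eta' d'.
Proof.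
move=> eta_le /andP[d'0 d'd] missK x Kx xd; apply: le_trans eta_le _; apply: missK => //.
apply: le_trans xd; nra.
Qed.

Lemma notin_misses_cap K q t : convex_set K -> compact K -> K !=set0 -> ~ K q ->
  enorm q <= t -> exists2 w, enorm w = 1 & forall d, misses_cap K w (1 - t) d.
Proof.
move=> cK coK K0 nKq qt; have [w w1 sep] := exists_separating_unit cK coK K0 nKq.
exists w => // d x Kx _.
have xw : dot x w <= t.
  by rewrite (le_trans (sep _ Kx))// (le_trans (dot_le_enorm _ _))// w1 mulr1.
have : dot (w - x) w <= enorm (w - x).
  by rewrite (le_trans (dot_le_enorm _ _))// w1 mulr1.
rewrite -[enorm (x - w)]enormN opprB dotDl dotNl -enorm_sqr w1; lra.
Qed.

(* A point of the symmetral in the thinner shell is within d' of a point of K. *)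
Lemma steiner_misses_cap u K z eta d eta' d' : u != 0 -> K `<=` eball 1 ->
  0 <= d' -> eta' + d' <= eta -> d' ^+ 2 + 2 * d' <= d ^+ 2 ->
  misses_cap K z eta d -> misses_cap (steiner u K) z eta' d'.
Proof.
move=> u0 K_sub d'0 eta_le sqr_le missK x Sx xd.
have [p Kp] := steiner_near u0 K_sub Sx; rewrite expr1n => xp2.
have x1 : enorm x <= 1 := steiner_sub_eball u0 K_sub Sx.
have xp : enorm (x - p) <= d' by rewrite enorm_le// (le_trans xp2)//; lra.
have xp_norm : enorm x <= enorm p + d'.
  by rewrite -[x](subrK p) (le_trans (enormD _ _))// addrC lerD2l.
have : eta <= enorm (p - z).
  apply: missK => //; rewrite -enorm_sqr; rewrite -enorm_sqr in xd.
  have x0 := enorm_ge0 x; have p0 := enorm_ge0 p.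
  have : enorm x ^+ 2 - 2 * (enorm x * d') <= enorm p ^+ 2.
    have [xd'|xd'] := leP (enorm x) d'; first by nra.
    have : (enorm x - d') ^+ 2 <= enorm p ^+ 2 by rewrite ler_sqr ?nnegrE; lra.
    nra.
  have : enorm x * d' <= d' by rewrite ler_piMl.
  lra.
have : enorm (p - z) <= enorm (p - x) + enorm (x - z).
  by rewrite -{1}(subrK x p) -addrA enormD.
rewrite -[enorm (p - x)]enormN opprB; lra.
Qed.

Lemma misses_cap_mirror u K z eta d : u != 0 ->
  misses_cap (steiner u K) (mirror u z) eta d -> misses_cap (steiner u K) z eta d.
Proof.
move=> u0 missK x Sx xd.
rewrite -(enorm_mirror u) mirrorD mirrorN; apply: missK; first exact: steiner_mirror.
by rewrite dot_mirror.
Qed.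

Lemma exists_cap_thickness eta eta' d : eta' < eta -> 0 < d -> exists d',
  [/\ 0 < d', d' <= d, eta' + d' <= eta & d' ^+ 2 + 2 * d' <= d ^+ 2].
Proof.
move=> eta_le d0; pose d' := Num.min (eta - eta') (Num.min 1 (Num.min d (d ^+ 2 / 3))).
have d'0 : 0 < d' by rewrite !lt_min subr_gt0 eta_le d0 divr_gt0 ?exprn_gt0 ?ltr01.
have d'_gap : d' <= eta - eta' by rewrite ge_min lexx.
have d'1 : d' <= 1 by rewrite !ge_min lexx !orbT.
have d'd : d' <= d by rewrite !ge_min lexx !orbT.
have d'd2 : d' <= d ^+ 2 / 3 by rewrite !ge_min lexx !orbT.
exists d'; split=> //; first lra.
have : d' ^+ 2 <= d' by rewrite expr2 ler_piMl// ltW.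
lra.
Qed.

Lemma net_misses_cap_sub_eball K (zs : seq V) eta d :
  (forall x, enorm x = 1 -> exists2 z, z \in zs & enorm (x - z) < eta / 2) ->
  K `<=` eball 1 -> d ^+ 2 < 1 -> d ^+ 2 <= eta / 2 ->
  {in zs, forall z, misses_cap K z eta d} -> K `<=` eball (Num.sqrt (1 - d ^+ 2)).
Proof.
move=> net K_sub d1 de missK x Kx; rewrite /eball /= enorm_le ?sqrtr_ge0//.
rewrite sqr_sqrtr; last lra.
rewrite leNgt; apply/negP => xd.
have x1 : enorm x <= 1 := K_sub _ Kx.
have x0 : 0 < enorm x.
  rewrite enorm_gt0; apply/eqP => xE; move: xd; rewrite xE dot0l; lra.
pose y := (enorm x)^-1 *: x.
have y1 : enorm y = 1 by rewrite enormZ gtr0_norm ?invr_gt0// mulVf// gt_eqF.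
have xy : enorm (x - y) = 1 - enorm x.
  have -> : x - y = (1 - enorm x) *: - y.
    by rewrite scalerN -scaleNr opprB scalerBl scale1r scalerA divff ?gt_eqF// scale1r.
  by rewrite enormZ enormN y1 mulr1 ger0_norm// subr_ge0.
have [z zzs yz] := net _ y1; have := missK z zzs x Kx (ltW xd).
have : enorm (x - z) <= enorm (x - y) + enorm (y - z).
  by rewrite -{1}(subrK y x) -addrA enormD.
rewrite -enorm_sqr in xd; nra.
Qed.

End Caps.

Section Rounding.
Variables (R : realType) (n m : nat).
Notation V := 'rV[R]_n.+1.
Implicit Types (K : set V) (z w : V).

Lemma spread_cap K z0 z (eta d eta' d' : R) : sym_body K -> K `<=` eball 1 ->
  enorm z0 = enorm z -> 0 <= d' <= d -> eta' + d' <= eta -> d' ^+ 2 + 2 * d' <= d ^+ 2 ->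
  exists K', [/\ sym_body K', psi_dominates m K K', K' `<=` eball 1,
    forall w, misses_cap K w eta d -> misses_cap K' w eta' d' &
    misses_cap K z0 eta d -> misses_cap K' z eta' d'].
Proof.
move=> bK K_sub zz d'd eta_le sqr_le; have /andP[d'0 _] := d'd.
have [<-|zz0] := eqVneq z0 z.
  have mono w : misses_cap K w eta d -> misses_cap K w eta' d'.
    by apply: misses_cap_mono => //; lra.
  by exists K; split=> //; [exact: psi_dominates_refl | exact: mono].
have u0 : z0 - z != 0 by rewrite subr_eq0.
have keep w : misses_cap K w eta d -> misses_cap (steiner (z0 - z) K) w eta' d'.
  exact: steiner_misses_cap.
exists (steiner (z0 - z) K); split=> //.
- exact: steiner_sym_body.
- exact: psi_dominates_steiner.
- exact: steiner_sub_eball.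
- move=> miss0; apply: misses_cap_mirror => //.
  by rewrite mirror_swap -?enorm_sqr ?zz//; exact: keep.
Qed.

Lemma spread_cap_seq (zs : seq V) (eta eta' d : R) :
  {in zs, forall z, enorm z = 1} -> eta' < eta -> 0 < d ->
  exists2 d', 0 < d' & forall K z0, sym_body K -> K `<=` eball 1 -> enorm z0 = 1 ->
    misses_cap K z0 eta d ->
    exists K', [/\ sym_body K', psi_dominates m K K', K' `<=` eball 1 &
      {in z0 :: zs, forall z, misses_cap K' z eta' d'}].
Proof.
elim: zs eta' => [|z zs IHzs] eta' zs1 eta_le d0.
  exists d => // K z0 bK K_sub _ miss0; exists K; split=> //; first exact: psi_dominates_refl.
  by move=> z; rewrite inE => /eqP ->; apply: misses_cap_mono miss0; rewrite ?lexx !ltW.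
have [||d1 d1_gt0 spread] := IHzs ((eta + eta') / 2) _ _ d0.
- by move=> w wzs; apply: zs1; rewrite inE wzs orbT.
- lra.
have eta'_mid : eta' < (eta + eta') / 2 by lra.
have [d' [d'0 d'd eta_le' sqr_le]] := exists_cap_thickness eta'_mid d1_gt0.
exists d' => // K z0 bK K_sub z01 miss0.
have [K2 [bK2 domK2 K2_sub missK2]] := spread K z0 bK K_sub z01 miss0.
have z0z : enorm z0 = enorm z by rewrite z01 zs1// mem_head.
have [|K3 [bK3 domK3 K3_sub keep spread0]] := spread_cap bK2 K2_sub z0z _ eta_le' sqr_le.
  by rewrite ltW.
exists K3; split=> //; first exact: psi_dominates_trans domK3.
move=> w; rewrite !inE orbCA => /predU1P[->|].
  by apply: spread0; apply: missK2; rewrite mem_head.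
by rewrite -in_cons => /missK2; exact: keep.
Qed.

Lemma exists_smaller_radius_unit (t : R) : 0 < t < 1 -> exists2 delta, 0 < delta < 1 &
  forall K, sym_body K -> K `<=` eball 1 -> ~ (eball t `<=` K) ->
    exists K', [/\ sym_body K', psi_dominates m K K' & K' `<=` eball delta].
Proof.
move=> /andP[t0 t1]; pose eta : R := (1 - t) / 2.
have [|zs [zs1 net]] := @finite_net_unit_sphere R n.+1 (eta / 2); first by rewrite /eta; lra.
have [|d1 d1_gt0 spread] := @spread_cap_seq zs (1 - t) eta 1 zs1 _ ltr01.
  by rewrite /eta; lra.
pose d := Num.min d1 (eta / 2).
have d0 : 0 < d by rewrite lt_min d1_gt0 /eta; lra.
have d_le : d <= d1 by rewrite ge_min lexx.
have deta : d <= eta / 2 by rewrite ge_min lexx orbT.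
have d2 : d ^+ 2 <= d by rewrite expr2 ler_piMl// ?ltW//; move: deta; rewrite /eta; lra.
have d2_lt1 : d ^+ 2 < 1 by move: deta; rewrite /eta; lra.
have d2_gt0 : 0 < d ^+ 2 by rewrite exprn_gt0.
exists (Num.sqrt (1 - d ^+ 2)) => [|K bK K_sub nK].
  by rewrite sqrtr_gt0 -{3}sqrtr1 ltr_sqrt ?ltr01//; lra.
have [K_empty|/set0P K_nonempty] := eqVneq K set0.
  by exists K; split=> //; [exact: psi_dominates_refl | rewrite K_empty].
have [cK coK _] := bK; have /existsNP[q /not_implyP[qt nKq]] := nK.
have [w w1 missw] := notin_misses_cap cK coK K_nonempty nKq qt.
have [K' [bK' domK' K'_sub missK']] := spread K w bK K_sub w1 (missw 1).
exists K'; split=> //; apply: (net_misses_cap_sub_eball net) => //; first lra.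
move=> z zzs; have d_itv : 0 <= d <= d1 by rewrite ltW.
by apply: misses_cap_mono (lexx eta) d_itv _; apply: missK'; rewrite inE zzs orbT.
Qed.

Lemma exists_smaller_radius (t : R) : 0 < t < 1 -> exists2 delta, 0 < delta < 1 &
  forall K rho, 0 < rho -> sym_body K -> K `<=` eball rho -> ~ (eball (t * rho) `<=` K) ->
    exists K', [/\ sym_body K', psi_dominates m K K' & K' `<=` eball (delta * rho)].
Proof.
move=> t01; have [delta delta01 shrink] := exists_smaller_radius_unit t01.
exists delta => // K rho rho0 bK Krho nK.
have rho_neq0 : rho != 0 by rewrite gt_eqF.
have [|||K' [bK' domK' K'delta]] := shrink ( *:%R rho^-1 @` K).
- exact: sym_body_scale.
- move=> _ [x /Krho xrho <-].
  by rewrite /eball /= enormZ gtr0_norm ?invr_gt0// ler_pdivrMl// mulr1.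
- move=> tK; apply: nK => x; rewrite /eball /= => xt.
  have [|y Ky /(scalerI _) <-//] := tK (rho^-1 *: x); last by rewrite invr_neq0.
  by rewrite /eball /= enormZ gtr0_norm ?invr_gt0// ler_pdivrMl// mulrC.
exists ( *:%R rho @` K'); split; first exact: sym_body_scale.
  by rewrite -[K](scale_imageKV _ rho_neq0); exact: psi_dominates_scale.
move=> _ [x /K'delta xdelta <-].
by rewrite /eball /= enormZ gtr0_norm// mulrC ler_pM2r.
Qed.

Lemma exists_expr_lt (q e : R) : 0 <= q < 1 -> 0 < e -> exists k, q ^+ k < e.
Proof.
move=> /andP[q0 q1] e0; have q_norm : `|q| < 1 by rewrite ger0_norm.
have /cvgrPdist_lt/(_ e e0)[k _ /(_ k (leqnn k))] := cvg_expr q_norm.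
by rewrite /= sub0r normrN ger0_norm ?exprn_ge0// => qk; exists k.
Qed.

(* Otherwise the radius could be divided by 1 / delta forever, while the volume
   never decreases. *)
Lemma exists_nearly_round K (t : R) : sym_body K -> (0 < vol K)%E -> 0 < t < 1 ->
  exists K' rho, [/\ 0 < rho, sym_body K', psi_dominates m K K',
    eball (t * rho) `<=` K' & K' `<=` eball rho].
Proof.
move=> bK vK t01; apply: contrapT => none.
have [delta /andP[delta0 delta1] shrink] := exists_smaller_radius t01.
have [_ coK _] := bK; have [r r0 Kr] := compact_sub_eball coK.
have radius_gt0 k : 0 < delta ^+ k * r by rewrite mulr_gt0// exprn_gt0.
have shrunk k : exists K',
    [/\ sym_body K', psi_dominates m K K' & K' `<=` eball (delta ^+ k * r)].
  elim: k => [|k [K1 [bK1 domK1 K1r]]].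
    by exists K; split; rewrite ?expr0 ?mul1r//; exact: psi_dominates_refl.
  have [|K2 [bK2 domK2 K2r]] := shrink K1 _ (radius_gt0 k) bK1 K1r.
    by move=> round; apply: none; exists K1, (delta ^+ k * r).
  by exists K2; split; [|exact: psi_dominates_trans domK2 | rewrite exprS -mulrA].
have vol_le k : (vol K <= ((delta ^+ k * r) ^+ n.+1)%:E * vol (eball 1 : set V))%E.
  have [K' [_ [KK' _] K'r]] := shrunk k.
  by rewrite -vol_eball//; apply: le_trans KK' _; exact: vol_mono.
have fB := vol_compact_fin_num (@compact_eball R n.+1 1).
have fK := vol_compact_fin_num coK.
pose b := fine (vol (eball 1 : set V)).
have b0 : 0 < b by rewrite /b -lte_fin fineK// vol_eball1_gt0.
have v0 : 0 < fine (vol K) by rewrite -lte_fin fineK.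
have rb0 : 0 < r ^+ n.+1 * b by rewrite mulr_gt0 ?exprn_gt0.
have [||k delta_k] := @exists_expr_lt delta (fine (vol K) / (r ^+ n.+1 * b)).
- by rewrite ltW.
- by rewrite divr_gt0.
have := vol_le k; rewrite -(fineK fK) -(fineK fB) -/b -EFinM lee_fin leNgt => /negP; apply.
move: delta_k; rewrite ltr_pdivlMr//; apply: le_lt_trans.
have deltak0 : 0 <= delta ^+ k by rewrite exprn_ge0 ?ltW.
have deltak1 : delta ^+ k <= 1 by rewrite exprn_ile1 ?ltW.
rewrite exprMn -mulrA ler_pM2r// exprS ler_piMr//.
exact: exprn_ile1.
Qed.

End Rounding.

(** * Comparison of psi *)

Lemma convex_translate (R : realType) n (w : 'rV[R]_n) K :
  convex_set K -> convex_set ((fun x => x + w) @` K).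
Proof.
move=> cK _ _ t [x Kx <-] [y Ky <-] t0 t1; exists (t *: x + (1 - t) *: y); first exact: cK.
by apply/rowP => i; rewrite !mxE; ring.
Qed.

Section Psi.
Variables (R : realType) (n m : nat).
Implicit Types A B K : set 'rV[R]_n.+1.

Lemma psi_dominates_le K K' : psi_dominates m K K' -> compact K -> compact K' ->
  (0 < vol K)%E -> (psi m K' 0 <= psi m K 0)%E.
Proof.
move=> [KK' dom] coK coK' vK; apply: psi_le => P PK'; have [Q QK PQ] := dom P PK'.
apply: le_trans (psi_ge QK).
have [/polytope_compact coP _ _] := PK'; have [/polytope_compact coQ _ _] := QK.
have fine_vol A := @vol_compact_fin_num R n A.
have k0 : 0 < fine (vol K) by rewrite -lte_fin fineK// fine_vol.
have kk' : fine (vol K) <= fine (vol K') by rewrite fine_le ?fine_vol.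
rewrite lee_fin ler_pM ?invr_ge0 ?fine_ge0 ?vol_ge0//; first by rewrite fine_le ?fine_vol.
by rewrite lef_pV2// posrE (lt_le_trans k0).
Qed.

Lemma psi_homothetic_sandwich B K (c d : R) : compact B -> (0 < vol B)%E -> compact K ->
  0 < c -> 0 < d -> *:%R c @` B `<=` K -> K `<=` *:%R d @` B ->
  (((c / d) ^+ n.+1)%:E * psi m B 0 <= psi m K 0)%E.
Proof.
move=> coB vB coK c0 d0 cBK KdB.
have cd0 : 0 < (c / d) ^+ n.+1 by rewrite exprn_gt0 ?divr_gt0.
rewrite -lee_pdivlMl//; apply: psi_le => P PB; rewrite lee_pdivlMl//.
have fB := vol_compact_fin_num coB; have fK := vol_compact_fin_num coK.
have fine_scale (a : R) A : 0 < a -> vol A \is a fin_num ->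
    fine (vol ( *:%R a @` A)) = a ^+ n.+1 * fine (vol A).
  by move=> a0 fA; rewrite vol_scale// fineM.
have Kdb : fine (vol K) <= d ^+ n.+1 * fine (vol B).
  rewrite -fine_scale// fine_le//; last exact: vol_mono.
  by rewrite vol_scale// fin_numM.
have k0 : 0 < fine (vol K).
  rewrite -lte_fin fineK//; apply: lt_le_trans (vol_mono cBK).
  by rewrite vol_scale// mule_gt0// lte_fin exprn_gt0.
have cPK : inscribed_polytope m K 0 ( *:%R c @` P).
  have := inscribed_polytope_scale c PB; rewrite scaler0 => -[plcP cPcB scP].
  by split=> //; exact: subset_trans cBK.
apply: le_trans (psi_ge cPK); have [/polytope_compact coP _ _] := PB.
rewrite fine_scale ?vol_compact_fin_num//.
rewrite -EFinM lee_fin expr_div_n mulf_div ler_wpM2l//.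
  by rewrite mulr_ge0 ?fine_ge0 ?vol_ge0// exprn_ge0// ltW.
by rewrite lef_pV2// posrE (lt_le_trans k0).
Qed.

End Psi.

Lemma exists_root01 (R : realType) n (r : R) : 0 < r < 1 ->
  exists2 t, 0 < t < 1 & t ^+ n.+1 = r.
Proof.
move=> /andP[r0 r1]; pose t := r `^ (n.+1%:R^-1); have t0 : 0 < t by exact: powR_gt0.
have tr : t ^+ n.+1 = r by rewrite -powR_mulrn ?ltW// -powRrM mulVf// powRr1// ltW.
exists t => //; rewrite t0 ltNge; apply: contraTN r1 => t1.
by rewrite -leNgt -tr exprn_ege1.
Qed.

(* A body between the balls of radii t rho and rho yields the bound up to the
   factor t^(n+1); let t tend to 1. *)
Lemma psi_unit_ball_le (R : realType) n m (K : set 'rV[R]_n.+1) :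
  sym_body K -> (0 < vol K)%E -> (psi m (@unit_ball R n.+1) 0 <= psi m K 0)%E.
Proof.
move=> bK vK; apply/lee_mul01Pr => [|r /(exists_root01 n)[t t01 <-]]; first exact: psi_ge0.
have [K' [rho [rho0 bK' domK' inK' K'in]]] := exists_nearly_round m bK vK t01.
have [_ coK _] := bK; have [_ coK' _] := bK'; have /andP[t0 _] := t01.
apply: le_trans (psi_dominates_le domK' coK coK' vK).
have <- : t * rho / rho = t by rewrite mulfK// gt_eqF.
rewrite unit_ballE; apply: psi_homothetic_sandwich => //; rewrite -?eball_scale ?mulr_gt0//.
- exact: compact_eball.
- exact: vol_eball1_gt0.
Qed.

Theorem theorem6 (R : realType) (n : nat) (K : set 'rV[R]_n) (o : 'rV[R]_n)
  (m : nat) :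
  convex_body K -> sym_about o K ->
  (psi m (@unit_ball R n) 0 <= psi m K o)%E.
Proof.
case: n K o => [|n] K o [cK coK iK] sK.
  have [x /interior_subset Kx] := iK.
  suff -> : K = @unit_ball R 0 by rewrite (thinmx0 o).
  apply/seteqP; split=> y _; first by rewrite /unit_ball /= big_ord0.
  by rewrite (thinmx0 y) -(thinmx0 x).
pose K0 := (fun x => x - o) @` K.
have bK0 : sym_body K0.
  split; first exact: convex_translate.
    by apply: compact_image coK; exact: continuous_translate.
  by rewrite -(subrr o); exact: sym_about_translate.
have vK0 : (0 < vol K0)%E by rewrite vol_translate; exact: vol_gt0.
apply: le_trans (psi_unit_ball_le m bK0 vK0) _.
have := psi_translate_le m o K0 0; rewrite add0r /K0 image_comp.
by rewrite (_ : _ \o _ = id) ?image_id//; apply/funext => x /=; rewrite subrK.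
Qed.
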